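(* There exist infinitely many Galois extensions $L/K$ of number fields and conjugacy classes $C_1,C_2\subset\mathrm{Gal}(L/K)$ for which $\delta(P_{L/K;C_1,C_2})=1$.
   Context: For a Galois extension $L/K$ of number fields with group $G=\mathrm{Gal}(L/K)$ and a conjugacy class $C\subset G$, the Frobenius counting function is $$\pi(x;L/K,C):=\#\{\mathfrak p\triangleleft\mathcal O_K \text{ prime ideal, unramified in } L:\ \mathcal N\mathfrak p\le x,\ \mathrm{Frob}_{\mathfrak p}=C\},$$ where $\mathrm{Frob}_{\mathfrak p}$ is the Frobenius conjugacy class in $G$ associated to the unramified prime $\mathfrak p$ and $\mathcal N\mathfrak p=|\mathcal O_K/\mathfrak p|$. For conjugacy classes $C_1,C_2\subset G$, $$P_{L/K;C_1,C_2}:=\{x\in\mathbb{R}_{\ge 1}: |C_2|\,\pi(x;L/K,C_1)>|C_1|\,\pi(x;L/K,C_2)\}.$$ The logarithmic density of $P_{L/K;C_1,C_2}$ is $$\delta(P_{L/K;C_1,C_2}):=\lim_{X\to\infty}\frac1{\log X}\int_{1\le x\le X,\ x\in P_{L/K;C_1,C_2}}\frac{dx}{x},$$ when this limit exists; the assertion $\delta(P_{L/K;C_1,C_2})=1$ includes the existence of the limit. *)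

(* Defs.v *)
From HB Require Import structures.
From mathcomp Require Import all_boot all_order all_algebra all_fingroup.
From mathcomp Require Import all_solvable all_field.
From mathcomp Require Import finmap all_classical all_reals all_analysis.

Set Implicit Arguments.
Unset Strict Implicit.
Unset Printing Implicit Defensive.

Import Order.TTheory GRing.Theory Num.Theory.
Import numFieldNormedType.Exports.

Local Open Scope classical_set_scope.
Local Open Scope ring_scope.

(* Number fields are the subfields of finite extensions of rat.  Every Galois *)
(* extension E / K of number fields embeds in a splitting field over rat (the *)
(* normal closure of E), so E and K are taken to be subfields of some         *)
(* L : splittingFieldType rat; E itself need not be normal over rat.          *)

Section RingOfIntegers.
Variables (L : fieldExtType rat) (K : {subfield L}).

Definition algint_in : {pred L} :=
  fun x => (x \in K) && `[< integralOver (intr : int -> L) x >].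

Fact algint_in_subring : subring_closed algint_in.
Proof.
have inP x : reflect (x \in K /\ integralOver (intr : int -> L) x)
               (x \in algint_in).
  by apply: (iffP andP) => -[Kx /asboolP].
split=> [|x y /inP[Kx Ix] /inP[Ky Iy]|x y /inP[Kx Ix] /inP[Ky Iy]]; apply/inP.
- by split; [exact: mem1v | exact: integral1].
- by split; [exact: rpredB | exact: integral_sub].
- by split; [exact: rpredM | exact: integral_mul].
Qed.

HB.instance Definition _ :=
  GRing.isSubringClosed.Build L algint_in algint_in_subring.

Record integers := Integers {
  integer_val : L;
  integer_valP : integer_val \in algint_in }.

HB.instance Definition _ := [isSub for integer_val].
HB.instance Definition _ := [Choice of integers by <:].
HB.instance Definition _ :=
  [SubChoice_isSubComNzRing of integers by <:].

End RingOfIntegers.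

Section Ideals.
Variable A : comNzRingType.
Implicit Types I J : set A.

(* idealr_closed includes properness (1 \notin I). *)
Definition prime_ideal I :=
  [/\ idealr_closed (mem I), prime_idealr_closed (mem I) & I <> [set 0]].

Definition ideal_mul I J : set A :=
  [set x | exists n (a b : 'I_n -> A),
    (forall i, I (a i) /\ J (b i)) /\ x = \sum_i a i * b i].

Definition ideal_exp I e : set A := iter e (ideal_mul I) setT.

(* #|A / I|, as the number of cosets of I; 0 if there are infinitely many *)
Definition ideal_norm I : nat :=
  #|` fset_set [set [set y | I (y - x)] | x in [set: A]] |%fset.

End Ideals.

Section Frobenius.
Variables (L : splittingFieldType rat) (E K : {subfield L}).
Implicit Types (p : set (integers K)) (P : set (integers E)).

Definition lies_over P p :=
  [set integer_val a | a in p] =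
  [set integer_val b | b in P] `&` [set` K].

Definition ideal_ext p : set (integers E) :=
  [set x | exists n (a : 'I_n -> integers K) (b : 'I_n -> integers E),
    (forall i, p (a i)) /\
    integer_val x = \sum_i integer_val (a i) * integer_val (b i)].

(* e is the exponent of P in the factorization of p O_E *)
Definition ramification_index P p (e : nat) :=
  ideal_ext p `<=` ideal_exp P e /\ ~ (ideal_ext p `<=` ideal_exp P e.+1).

(* Residue field extensions are automatically separable here. *)
Definition unramified p :=
  forall P, prime_ideal P -> lies_over P p -> ramification_index P p 1.

Definition frobenius_at P p (s : gal_of E) :=
  s \in 'Gal(E / K)%g /\
  forall x : integers E,
    [set integer_val b | b in P] 
      (s (integer_val x) - integer_val x ^+ ideal_norm p).

(* The Frobenius elements at all the primes of O_E above p *)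
Definition Frob p : {set gal_of E} :=
  [set s | `[< exists P,
     [/\ prime_ideal P, lies_over P p & frobenius_at P p s] >]]%SET.

Definition frobenius_count (R : realType) (x : R) (C : {set gal_of E}) : nat :=
  #|` fset_set [set p | [/\ prime_ideal p, unramified p,
                           (ideal_norm p)%:R <= x & Frob p = C]] |%fset.

Definition bias_set (R : realType) (C1 C2 : {set gal_of E}) : set R :=
  [set x | 1 <= x /\
    (#|C2| * frobenius_count x C1 > #|C1| * frobenius_count x C2)%N].

End Frobenius.

Definition has_log_density (R : realType) (S : set R) (d : R) :=
  (ln X)^-1 * (\int[lebesgue_measure]_(x in `[1, X] `&` S) x^-1)
    @[X --> +oo] --> d.

Record galois_ext := GaloisExt {
  ge_ambient : splittingFieldType rat;
  ge_top : {subfield ge_ambient};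
  ge_base : {subfield ge_ambient};
  ge_galois : galois ge_base ge_top }.

Definition galois_ext_iso (X Y : galois_ext) : Prop :=
  exists f : {rmorphism subvs_of (ge_top X) -> subvs_of (ge_top Y)},
    bijective f /\
    forall x, (vsval x \in ge_base X) = (vsval (f x) \in ge_base Y).

(* Main.v *)
Require Import Defs.
From HB Require Import structures.
From mathcomp Require Import all_boot all_order all_algebra all_fingroup.
From mathcomp Require Import all_solvable all_field.
From mathcomp Require Import finmap all_classical all_reals all_analysis.
From mathcomp Require Import zify ring lra.

Set Implicit Arguments.
Unset Strict Implicit.
Unset Printing Implicit Defensive.

Import Order.TTheory GRing.Theory Num.Theory.
Import numFieldNormedType.Exports.

Local Open Scope classical_set_scope.
Local Open Scope ring_scope.

(** For an odd prime [q], let [A] and [B] be fourth roots of the conjugate Gaussian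
    numbers [q (1 + i)] and [q (1 - i)], and put [L = Q(i, A, B)] and
    [K = Q(i, B ^ 2)].  Then [L] is Galois over the rationals, [L / K] is
    abelian, and [Gal(L / K)] contains [X : A |-> - A, B |-> B] and
    [Y : A |-> A, B |-> - B].  They are not conjugate over [K], but any [g] in
    [Gal(L / Q)] with [g i = - i] exchanges the fourth roots up to powers of
    [i] and hence conjugates [Y] to [X] ([swap_conj]).  The primes of [K] of
    degree one over the rationals therefore have Frobenius element [X] as
    often as [Y], and a bias can only come from the primes of higher degree.

    These are examined over a rational prime [p] not dividing [2 q].  If [p] is
    inert in the Gaussian field then [A ^ 4] is the [p]-th power of [B ^ 4] in
    the residue field, so the Frobenius element cannot negate [A] and fix [B]
    ([quartic_root_inert]).  If [p = 1 (mod 4)] and the prime has degree two,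
    then [B ^ (p ^ 2) = - B] in the residue field ([frob2_nonsquare]), which
    excludes [X]; and this case occurs with Frobenius element [Y], for instance
    over every [p = 5 (mod 8)], where exactly one of [q (1 + i)] and
    [q (1 - i)] is a square modulo [p] ([inert_prime_exists]).  So, up to the
    finitely many primes over [2 q], the primes with Frobenius element [X]
    inject into those with Frobenius element [Y], and the image misses one
    prime of norm [p ^ 2] for each such [p].  There are infinitely many of
    them, so the count of [Y] eventually exceeds that of [X]
    ([frobenius_count_lt]), and a set containing a half-line has logarithmic
    density 1 ([log_density_one]).

    The arithmetic of [L] is accessible because [L] is reached from the
    rationals by adjoining the square roots [i], [B ^ 2], [A ^ 2], [A], [B] in
    turn: every integer of [L] becomes a polynomial in [i], [A], [B] after
    multiplication by a power of [2 q] ([covers_full]).  Hence away from [2 q] a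
    Frobenius congruence only has to be checked on [i], [A] and [B]
    ([frobenius_generators]), and the ring of integers modulo [p] is reduced,
    which gives unramifiedness ([prime_notin_sqr]).

    Different odd primes [q] and [q'] give non-isomorphic extensions: otherwise
    [q q'] or [2 q q'] would be a square ([bq_ext_not_iso]). *)

(** * Quotients and prime ideals of commutative rings *)

Section Quotient.
Variable A : comNzRingType.
Implicit Type I : set A.

Lemma idealrP I : idealr_closed (mem I) <->
  [/\ I 0, ~ I 1 & forall a u v, I u -> I v -> I (a * u + v)].
Proof.
split=> -[I0 I1 IM]; split=> //.
- by move: I0; rewrite inE.
- by move: I1; rewrite notin_setE.
- by move=> a u v Iu Iv; move: (IM a u v); rewrite !inE; apply.
- by rewrite inE.
- by rewrite notin_setE.
- by move=> a u v; rewrite !inE; exact: IM.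
Qed.

Lemma quotient_ring I : idealr_closed (mem I) ->
  exists (k : comNzRingType) (f : {rmorphism A -> k}),
    (forall x, f x = 0 <-> I x) /\ (forall y, exists x, f x = y).
Proof.
move=> idI.
pose S : A -> bool := fun x => x \in I.
have idS : idealr_closed S by case: idI => *; split.
pose J := isIdealr.Build A S idS.
pose JJ : idealr A := HB.pack S J.
exists (Quotient.quot JJ), (\pi_(Quotient.quot JJ)%qT); split.
  move=> x; have -> : I x = (x \in I) by rewrite inE.
  have <- : (x \in JJ) = (x \in I) by [].
  rewrite -[x in x \in JJ]subr0 Quotient.idealrBE.
  rewrite -(rmorph0 (\pi_(Quotient.quot JJ))%qT); split; first by move=> ->.
  by move/eqP.
by move=> y; exists (generic_quotient.repr y); exact: generic_quotient.reprK.
Qed.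

(** An integral domain with a unit structure, chosen classically: this makes
    the bound on the number of roots of a polynomial available. *)
Lemma residue_domain I : idealr_closed (mem I) -> prime_idealr_closed (mem I) ->
  exists (k : idomainType) (f : {rmorphism A -> k}),
    forall x, f x = 0 <-> I x.
Proof.
move=> idI prI; have [k [f [fI fs]]] := quotient_ring idI.
have dom (x y : k) : x * y = 0 -> (x == 0) || (y == 0).
  have [[u <-] [v <-]] := (fs x, fs y).
  rewrite -rmorphM fI => Iuv; have := prI u v; rewrite !inE => /(_ Iuv).
  by case/orP=> /set_mem/fI ->; rewrite eqxx ?orbT.
pose un : pred k := fun x => `[< exists y, y * x = 1 >].
pose inv (x : k) : k := if pselect (exists y, y * x = 1) is left h
  then projT1 (cid h) else x.
have invl : {in un, left_inverse 1 inv *%R}.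
  move=> x /asboolP ux; rewrite /inv; case: pselect => // h.
  exact: projT2 (cid h).
have unP x y : y * x = 1 -> un x by move=> h; apply/asboolP; exists y.
have invo : {in [predC un], inv =1 id}.
  move=> x; rewrite inE => /negP nx; rewrite /inv; case: pselect => // h.
  by case: nx; apply/asboolP.
pose U := GRing.ComNzRing_hasMulInverse.Build k invl unP invo.
pose kU : comUnitRingType := HB.pack k U.
pose D := GRing.ComUnitRing_isIntegral.Build kU dom.
pose kD : idomainType := HB.pack kU D.
by exists kD, f.
Qed.

(** An ideal maximal among the proper ideals containing [I] is prime. *)
Lemma prime_above I : idealr_closed (mem I) -> exists P : set A,
  [/\ idealr_closed (mem P), prime_idealr_closed (mem P) & I `<=` P].
Proof.
move=> idI; pose good (X : set A) := idealr_closed (mem X) /\ I `<=` X.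
(* The empty set is admitted because it is the union of the empty chain. *)
have [F FP Ftot|M [[M0|[idM IM]] Mmax]] :=
  @Zorn_bigcup A [set X | X = set0 \/ good X].
- have [[X FX [x Xx]]|nX] := pselect (exists2 X, F X & X !=set0); last first.
    left; rewrite -subset0 => x [X FX Xx]; apply: nX; exists X => //.
    by exists x.
  right; have gX Y : F Y -> Y !=set0 -> good Y.
    by move=> FY [y Yy]; case: (FP _ FY) => // Y0; rewrite Y0 in Yy.
  have [/idealrP[X0 X1 XM] IX] := gX X FX (ex_intro _ x Xx); split; last first.
    by move=> y Iy; exists X => //; exact: IX.
  apply/idealrP; split.
  + by exists X.
  + move=> [Y FY Y1]; have [/idealrP[_ nY1 _] _] := gX Y FY (ex_intro _ 1 Y1).
    by [].
  + move=> a u v [Y FY Yu] [Z FZ Zv].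
    have [/idealrP[_ _ YM] _] := gX Y FY (ex_intro _ u Yu).
    have [/idealrP[_ _ ZM] _] := gX Z FZ (ex_intro _ v Zv).
    have [YZ|ZY] := Ftot Y Z FY FZ.
      by exists Z => //; apply: ZM => //; exact: YZ.
    by exists Y => //; apply: YM => //; exact: ZY.
- case: (Mmax I); last by right; split.
  split; last by rewrite M0 => h; have /idealrP[I0 _ _] := idI; exact: (h 0).
  by rewrite M0.
exists M; split=> // u v; rewrite !inE => Muv.
apply/orP; rewrite !inE; have [Mu|nMu] := pselect (M u); first by left.
right; have /idealrP[M0 M1 MM] := idM.
pose N := [set x | exists a m, M m /\ x = a * u + m].
have [[a [m [Mm e]]]|N1] := pselect (N 1).
  have -> : v = v * m + a * (u * v) by rewrite -[LHS]mulr1 e; ring.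
  have Maux : M (a * (u * v) + 0) by apply: MM.
  by rewrite -[a * _]addr0; apply: MM.
case: (Mmax N).
  split; last first.
    by move=> NM; apply: nMu; apply: NM; exists 1, 0; rewrite mul1r addr0.
  by move=> x Mx; exists 0, x; rewrite mul0r add0r.
right; split; last by move=> x /IM Mx; exists 0, x; rewrite mul0r add0r.
apply/idealrP; split=> //; first by exists 0, 0; rewrite mul0r add0r.
move=> c x y [a [m [Mm ->]]] [b [n [Mn ->]]].
exists (c * a + b), (c * m + n); split; first exact: MM.
by ring.
Qed.

End Quotient.

(** * Fourth roots of [q (1 + i)] and [q (1 - i)] in characteristic [p] *)

Section CharP.
Variables (k : comNzRingType) (p : nat).
Hypothesis chp : p \in [pchar k].
Implicit Types x y : k.

Lemma frobD n x y : (x + y) ^+ (p ^ n) = x ^+ (p ^ n) + y ^+ (p ^ n).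
Proof.
apply: exprDn_pchar; rewrite pnatX (eq_pnat _ (pcharf_eq chp)) pnat_id //.
exact: pcharf_prime chp.
Qed.

Lemma frob_nat n m : (m%:R : k) ^+ (p ^ n) = m%:R.
Proof.
elim: n => [|n IH]; first by rewrite expr1.
by rewrite expnS exprM -(pFrobenius_autE chp) pFrobenius_aut_nat.
Qed.

Lemma frobN n x : (- x) ^+ (p ^ n) = - x ^+ (p ^ n).
Proof.
apply/eqP; rewrite -addr_eq0 -frobD addNr expr0n expn_eq0.
by have := pcharf_prime chp; case: (p).
Qed.

Lemma natr_unit n : coprime n p -> exists c : k, c * n%:R = 1.
Proof.
have pp := pcharf_prime chp; have p0 := prime_gt0 pp.
rewrite coprime_sym => /(coprimeP _ p0)[[u v] /= e].
exists (- v%:R); have := congr1 (fun i => (i%:R : k)) e.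
rewrite natrB; last by lia.
by rewrite !natrM (pcharf0 chp) mulr0 add0r mulNr.
Qed.

Lemma natr_eq_mod m n : (m%:R = n%:R :> k) -> m = n %[mod p].
Proof.
wlog le_mn : m n / (n <= m)%N.
  by move=> W; case: (leqP n m) => [/W//|/ltnW/W h /esym/h].
move=> e; apply/eqP; rewrite eqn_mod_dvd // (dvdn_pcharf chp) natrB // e.
by rewrite subrr.
Qed.

Lemma expr_imag_mod4 (i : k) n r : i ^+ 2 = -1 -> (n %% 4)%N = r -> i ^+ n = i ^+ r.
Proof.
move=> i2 <-; rewrite {1}(divn_eq n 4) exprD mulnC exprM.
by rewrite (exprM i 2 2) i2 sqrrN !expr1n mul1r.
Qed.

End CharP.

Section FourthRoot.
Variables (k : comNzRingType) (p q : nat).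
Hypothesis chp : p \in [pchar k].
Variables (i g : k).
Hypothesis i2 : i ^+ 2 = -1.
Hypothesis g4 : g ^+ 4 = q%:R * (1 + i).
Hypothesis p2q : coprime (2 * q) p.

(** The unit [a = q (1 + i)] satisfies [a ^ (p ^ 2 - 1) = 1], and
    [4 (p ^ 2 - 1)] divides [p ^ 8 - 1] because 8 divides [p ^ 2 - 1].  Applied
    to the ring of integers modulo [p], this shows that it is reduced. *)
Lemma fourth_root_frob8 : g ^+ (p ^ 8) = g.
Proof.
have pp := pcharf_prime chp.
have po : odd p.
  case: (even_prime pp) => // p2; move: p2q; rewrite p2 coprimeMl.
  by [].
have [c hc] : exists c : k, c * (2 * q ^ 2)%:R = 1.
  move: p2q; rewrite coprimeMl => /andP[c2 cq].
  by apply: (natr_unit chp); rewrite coprimeMl c2 coprimeXl.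
pose a := g ^+ 4; have ea : a = q%:R * (1 + i) by [].
have aa : a * (c * q%:R * (1 - i)) = 1.
  rewrite ea -[RHS]hc natrM natrX.
  transitivity (c * (q%:R ^+ 2 * (1 - i ^+ 2))); first by ring.
  by rewrite i2 opprK mulrC; ring.
have p8 : exists t, (p ^ 2 = 8 * t + 1)%N.
  exists ((p ^ 2) %/ 8)%N; rewrite [LHS](divn_eq _ 8) mulnC; congr addn.
  rewrite -modnXm; have : (p %% 8 < 8)%N by rewrite ltn_mod.
  have : odd (p %% 8)%N by rewrite odd_mod.
  by case: (p %% 8)%N => [|[|[|[|[|[|[|[|]]]]]]]].
case: p8 => t ht.
have ap : a ^+ (p ^ 2) = a.
  rewrite ea exprMn (frob_nat chp) (frobD chp) expr1n ht exprD.
  rewrite (_ : 8 * t = 2 * (2 * (2 * t)))%N; last by lia.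
  by rewrite !exprM i2 sqrrN !expr1n mul1r.
have a1 : a ^+ (8 * t) = 1.
  rewrite -[LHS]mulr1 -{1}aa mulrA -exprSr -addn1 -ht ap aa //.
have -> : (p ^ 8 = 4 * ((8 * t) * ((4 * t + 1) * (32 * t * t + 8 * t + 1))) + 1)%N.
  by rewrite (expnM p 2 4) ht; lia.
by rewrite exprD exprM -/a (exprM a) a1 expr1n mul1r.
Qed.
End FourthRoot.

Section ResidueDomain.
Variables (k : idomainType) (p q : nat).
Hypothesis chp : p \in [pchar k].
Hypothesis p2q : coprime (2 * q) p.
Variable i : k.
Hypothesis i2 : i ^+ 2 = -1.
Let pp := pcharf_prime chp.

Lemma natr_neq0 n : coprime n p -> n%:R != 0 :> k.
Proof.
move=> /(natr_unit chp)[c e]; apply/eqP => n0.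
by move: e; rewrite n0 mulr0 => /esym/eqP; rewrite oner_eq0.
Qed.

Lemma residue_char_odd : odd p.
Proof.
by case: (even_prime pp) => // p2; move: p2q; rewrite p2 coprimeMl.
Qed.

Lemma residue_two_neq0 : 2 != 0 :> k.
Proof. by apply: natr_neq0; move: p2q; rewrite coprimeMl => /andP[]. Qed.

Lemma residue_q_neq0 : q%:R != 0 :> k.
Proof. by apply: natr_neq0; move: p2q; rewrite coprimeMl => /andP[]. Qed.

Lemma eqr_opp0 (x : k) : x = - x -> x = 0.
Proof.
move=> e; have /eqP : 2 * x = 0 by rewrite mulr_natl mulr2n {2}e subrr.
by rewrite mulf_eq0 (negPf residue_two_neq0) => /eqP.
Qed.

Lemma quartic_root_neq0 (e g : k) : e ^+ 2 = -1 -> g ^+ 4 = q%:R * (1 + e) -> g != 0.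
Proof.
move=> e2 g4; apply/eqP => g0; move: g4; rewrite g0 expr0n /= => /esym/eqP.
rewrite mulf_eq0 (negPf residue_q_neq0) /= => /eqP e1.
have : (1 + e) * (1 - e) = 0 by rewrite e1 mul0r.
have -> : (1 + e) * (1 - e) = 1 - e ^+ 2 by ring.
by rewrite e2 opprK => /eqP; rewrite -[_ + _]/2 (negPf residue_two_neq0).
Qed.

Lemma sqr_eq_cases (x y : k) : x ^+ 2 = y ^+ 2 -> x = y \/ x = - y.
Proof. by move/eqP; rewrite eqf_sqr => /orP[]/eqP; [left|right]. Qed.

Lemma fourth_eq_cases (x y : k) : x ^+ 4 = y ^+ 4 ->
  exists n, x = i ^+ n * y.
Proof.
rewrite (exprM x 2 2) (exprM y 2 2) => /sqr_eq_cases[].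
  case/sqr_eq_cases=> ->; first by exists 0%N; rewrite mul1r.
  by exists 2%N; rewrite i2 mulN1r.
rewrite -mulN1r -i2 -exprMn => /sqr_eq_cases[] ->; first by exists 1%N.
by exists 3%N; rewrite exprS i2 mulrN1 mulNr.
Qed.

(** The [p] residues of the natural numbers already exhaust the roots of
    [X ^ p - X]. *)
Lemma frob_fixed_nat (x : k) : x ^+ p = x -> exists n, (n < p)%N /\ x = n%:R.
Proof.
move=> xp; pose s := [seq (j%:R : k) | j <- iota 0 p].
case: (boolP (x \in s)).
  by case/mapP=> n; rewrite mem_iota => /andP[_ np] ->; exists n.
move=> xs; have := @max_poly_roots k ('X^p - 'X) (x :: s).
have sz : size ('X^p - 'X : {poly k}) = p.+1.
  by rewrite size_polyDl ?size_polyXn // size_polyN size_polyX ltnS prime_gt1.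
rewrite sz /= size_map size_iota ltnn => h; exfalso.
suff: false by []; apply: h.
- by rewrite -size_poly_eq0 sz.
- rewrite rootE !hornerE xp subrr eqxx /=; apply/allP => _ /mapP[j _ ->].
  by rewrite rootE !hornerE -[p in X in X - _]expn1 (frob_nat chp 1) subrr.
- rewrite xs map_inj_in_uniq ?iota_uniq // => m n.
  rewrite !mem_iota !add0n => /andP[_ mp] /andP[_ np] /(natr_eq_mod chp).
  by rewrite !modn_small.
Qed.

(** Here [q (1 + i)] is the [p]-th power of [q (1 - i)], so [a] is a power of
    [i] times [w ^ p] and is fixed by whatever fixes [i] and [w]. *)
Lemma quartic_root_inert (a w : k) N : (p %% 4)%N = 3%N ->
  a ^+ 4 = q%:R * (1 + i) -> w ^+ 4 = q%:R * (1 - i) ->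
  i ^+ N = i -> w ^+ N = w -> a ^+ N = - a -> False.
Proof.
move=> p3 ha hw iN wN aN.
have e : a ^+ 4 = (w ^+ p) ^+ 4.
  rewrite -exprM mulnC exprM hw ha -[p in RHS]expn1 exprMn (frob_nat chp).
  rewrite (frobD chp) expr1n (frobN chp) expn1 (expr_imag_mod4 i2 p3) exprS i2.
  by rewrite mulrN1 opprK.
have [n en] := fourth_eq_cases e.
have : a = - a.
  rewrite -aN en exprMn -exprM mulnC exprM iN -exprM mulnC exprM wN //.
move/eqr_opp0; apply/eqP; exact: quartic_root_neq0 i2 ha.
Qed.

Section Split.
Hypothesis p1 : (p %% 4)%N = 1%N.

Lemma frob_i : i ^+ p = i.
Proof. exact: expr_imag_mod4 i2 p1. Qed.

Variables (e g : k).
Hypotheses (e2 : e ^+ 2 = -1) (g4 : g ^+ 4 = q%:R * (1 + e)).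

Lemma sqr_frob : (g ^+ 2) ^+ p = g ^+ 2 \/ (g ^+ 2) ^+ p = - g ^+ 2.
Proof.
apply: sqr_eq_cases; transitivity ((g ^+ 4) ^+ p).
  by rewrite -!exprM; rewrite (mulnC p) mulnA.
rewrite -[RHS]exprM -[(2 * 2)%N]/4%N g4 exprMn -[p]expn1 (frob_nat chp).
rewrite (frobD chp) expr1n expn1.
by rewrite (expr_imag_mod4 e2 p1).
Qed.

Lemma frob1N (x : k) : (- x) ^+ p = - x ^+ p.
Proof. by rewrite -[p]expn1 (frobN chp). Qed.

(** The hypothesis makes [g ^ p] equal to [i g] or [- i g], and applying the
    Frobenius map once more multiplies [g] by [i ^ 2]. *)
Lemma frob2_nonsquare : (g ^+ 2) ^+ p = - g ^+ 2 -> g ^+ (p ^ 2) = - g.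
Proof.
move=> h; have : (g ^+ p) ^+ 2 = (i * g) ^+ 2.
  by rewrite exprMn i2 mulN1r -h -!exprM mulnC.
rewrite [(p ^ 2)%N]expnS expn1 exprM.
case/sqr_eq_cases=> E; rewrite E; last rewrite frob1N.
  by rewrite exprMn frob_i E mulrA -expr2 i2 mulN1r.
by rewrite exprMn frob_i E mulrN opprK mulrA -expr2 i2 mulN1r.
Qed.

Lemma frob2_square : (g ^+ 2) ^+ p = g ^+ 2 -> g ^+ (p ^ 2) = g.
Proof.
move=> h; have : (g ^+ p) ^+ 2 = g ^+ 2 by rewrite -[RHS]h -!exprM mulnC.
rewrite [(p ^ 2)%N]expnS expn1 exprM.
by case/sqr_eq_cases=> E; rewrite E ?frob1N E ?opprK.
Qed.

End Split.

(** For [p] congruent to 5 modulo 8, [i] is a non-square in the prime field,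
    so exactly one of the conjugates [q (1 + i)] and [q (1 - i)] is a square. *)
Lemma sqr_frob_opp (a w : k) : (p %% 8)%N = 5%N ->
  a ^+ 4 = q%:R * (1 + i) -> w ^+ 4 = q%:R * (1 - i) ->
  w ^+ 2 * (a ^+ 2) ^+ p = - (a ^+ 2 * (w ^+ 2) ^+ p).
Proof.
move=> p5 ha hw.
have [t ep] : exists t, (p = (t * 2 + 1) * 4 + 1)%N.
  by exists (p %/ 8)%N; rewrite {1}(divn_eq p 8) p5; lia.
have haw : a ^+ 4 = i * w ^+ 4.
  by rewrite ha hw mulrCA mulrBr -expr2 i2 opprK mulr1 [i + 1]addrC.
pose n := (2 * (t * 2 + 1))%N.
have key (x : k) : (x ^+ 2) ^+ p = x ^+ 2 * (x ^+ 4) ^+ n.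
  by rewrite -!exprM -exprD ep /n; congr (_ ^+ _); lia.
have iN : i ^+ n = -1.
  by rewrite /n exprM i2 exprD [(t * 2)%N]mulnC exprM sqrrN !expr1n mul1r.
rewrite !key haw exprMn iN.
by ring.
Qed.

End ResidueDomain.

(** * Primes congruent to 5 modulo 8 *)

Section PrimesFiveModEight.

(** [- 1] is the square of [x / 2] modulo [p]. *)
Lemma odd_prime_dvd_sqr_add4 p x : prime p -> odd p -> (p %| x ^ 2 + 4)%N ->
  (p %% 4 = 1)%N.
Proof.
move=> pp po pd; have p4 : (p %% 4 = 1 \/ p %% 4 = 3)%N.
  have : (p %% 4 < 4)%N by rewrite ltn_mod.
  have : odd (p %% 4)%N by rewrite odd_mod.
  by case: (p %% 4)%N => [|[|[|[|]]]] // _ _; [left|right].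
case: p4 => // p3; have chp : p \in [pchar 'F_p] by exact: pchar_Fp.
have t0 : 2 != 0 :> 'F_p.
  rewrite -(dvdn_pcharf chp) dvdn_prime2 //; apply: contraL po => /eqP ->.
  by [].
pose y : 'F_p := x%:R / 2.
have y2 : y ^+ 2 = -1.
  have : (x ^ 2 + 4)%:R = 0 :> 'F_p by apply/eqP; rewrite -(dvdn_pcharf chp).
  rewrite natrD natrX => /eqP; rewrite addr_eq0 => /eqP e.
  rewrite /y expr_div_n e mulNr; congr (- _).
  by rewrite (_ : 4%:R = 2 ^+ 2) ?divff ?expf_neq0 // -natrX.
have yp : y ^+ p = y.
  by rewrite -[y]natr_Zp -[p in X in _ ^+ X = _]expn1 (frob_nat chp).
have : y = - y by rewrite -{1}yp (expr_imag_mod4 y2 p3) exprS y2 mulrN1.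
move/eqP; rewrite -addr_eq0 -mulr2n -mulr_natl mulf_eq0 (negPf t0) /= => /eqP y0.
by move: y2; rewrite y0 expr0n /= => /esym/eqP; rewrite oppr_eq0 oner_eq0.
Qed.

Lemma one_mod8_of_primes n : (0 < n)%N ->
  (forall p, prime p -> (p %| n)%N -> (p %% 8 = 1)%N) -> (n %% 8 = 1)%N.
Proof.
elim/ltn_ind: n => n IH n0 np; have [n1|n1] := leqP n 1.
  by case: n n0 n1 {IH np} => [|[|]].
have pp := pdiv_prime n1; have pd := pdiv_dvd n.
rewrite -(divnK pd) -modnMm (np _ pp pd) (IH (n %/ pdiv n)%N) //.
- by rewrite ltn_Pdiv // prime_gt1.
- by rewrite divn_gt0 ?pdiv_gt0 // dvdn_leq.
- by move=> p p' pdv; apply: np => //; apply: dvdn_trans pdv (dvdn_div pd).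
Qed.

(** For [x] odd, [x ^ 2 + 4 = 5 (mod 8)] has only prime factors congruent to
    1 modulo 4, so one of them is congruent to 5 modulo 8; it exceeds [n] when
    [x] is divisible by the odd numbers up to [n]. *)
Lemma prime_5mod8_above n : exists p, [/\ (n < p)%N, prime p & (p %% 8 = 5)%N].
Proof.
pose x := (\prod_(j < n.+1) (2 * j + 1))%N.
have ox : odd x.
  rewrite /x; elim/big_ind: _ => // [a b|j _]; first by rewrite oddM => -> ->.
  by rewrite oddD oddM.
pose N := (x ^ 2 + 4)%N.
have N5 : (N %% 8 = 5)%N.
  rewrite /N -modnDml -modnXm.
  have : (x %% 8 < 8)%N by rewrite ltn_mod.
  have : odd (x %% 8)%N by rewrite odd_mod.
  by case: (x %% 8)%N => [|[|[|[|[|[|[|[|]]]]]]]].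
have [p [pp pN p5]] : exists p, [/\ prime p, (p %| N)%N & (p %% 8 = 5)%N].
  apply: contrapT => h; have : (N %% 8 = 1)%N; last by rewrite N5.
  apply: one_mod8_of_primes; first by rewrite /N addn_gt0 orbT.
  move=> p pp pN; have po : odd p.
    case: (even_prime pp) => // p2; move: pN; rewrite p2 dvdn2 /N oddD oddX ox.
    by [].
  have p1 := odd_prime_dvd_sqr_add4 pp po pN.
  have : (p %% 8 = 1 \/ p %% 8 = 5)%N.
    have : ((p %% 8) %% 4 = 1)%N by rewrite modn_dvdm.
    have : (p %% 8 < 8)%N by rewrite ltn_mod.
    by case: (p %% 8)%N => [|[|[|[|[|[|[|[|]]]]]]]] // _ _; [left|right].
  by case=> // p5; case: h; exists p.
exists p; split=> //; rewrite ltnNge; apply/negP => pn.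
have po : odd p.
  by rewrite -(@odd_mod p 8) // p5.
have px : (p %| x)%N.
  have jn : (p./2 < n.+1)%N.
    by rewrite ltnS (leq_trans _ pn) // -{2}(odd_double_half p) -addnn; lia.
  rewrite /x (bigD1 (Ordinal jn)) //=; apply: dvdn_mulr.
  have := odd_double_half p; rewrite po -mul2n => e.
  by rewrite addnC [X in (p %| X)%N]e.
have : (p %| 4)%N by rewrite -(dvdn_addr _ (dvdn_mulr x px)); exact: pN.
rewrite (_ : 4 = 2 ^ 2)%N // (Euclid_dvdX _ _ pp) /= andbT dvdn_prime2 //.
by move=> /eqP p2; move: po; rewrite p2.
Qed.

Lemma primes_5mod8 n m : exists ps : seq nat, [/\ uniq ps, size ps = m &
  forall p, p \in ps -> [/\ (n < p)%N, prime p & (p %% 8 = 5)%N]].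
Proof.
elim: m => [|m [ps [ups sps hps]]]; first by exists [::].
have [p [np pp p5]] := prime_5mod8_above (n + \sum_(r <- ps) r).
exists (p :: ps); split.
- rewrite /= ups andbT; apply/negP => pps.
  by move: np; rewrite (big_rem p) //=; lia.
- by rewrite /= sps.
move=> r; rewrite inE => /orP[/eqP ->|/hps //]; split=> //.
by apply: leq_ltn_trans np; rewrite leq_addr.
Qed.

End PrimesFiveModEight.

(** * Logarithmic density of a set containing a half-line *)

Section LogDensity.
Variable R : realType.
Notation mu := (@lebesgue_measure R).
Implicit Types (S : set R) (a b x : R).

Lemma Rintegral_subset (A B : set R) (f : R -> R) :
  measurable A -> measurable B -> A `<=` B ->
  mu.-integrable B (EFin \o f) -> (forall x, B x -> 0 <= f x) ->
  \int[mu]_(x in A) f x <= \int[mu]_(x in B) f x.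
Proof.
move=> mA mB AB fB f0; have eB : B = A `|` (B `\` A).
  by rewrite setUDr setUidr // setDv setD0.
rewrite [in leRHS]eB Rintegral_setU -?eB //.
- by rewrite lerDl; apply: Rintegral_ge0 => x [Bx _]; exact: f0.
- exact: measurableD.
- by apply/disj_setPS => x [Ax [_ nAx]].
Qed.

Lemma inv_continuous_itv a b : 0 < a ->
  {within `[a, b], continuous (fun x : R => x^-1)}.
Proof.
move=> a0; apply: continuous_in_subspaceT => x; rewrite inE /= in_itv /=.
move=> /andP[ax _]; apply: inv_continuous; apply: lt0r_neq0.
exact: lt_le_trans ax.
Qed.

Lemma inv_integrable a b : 0 < a ->
  mu.-integrable `[a, b] (EFin \o (fun x : R => x^-1)).
Proof.
move=> a0; apply: continuous_compact_integrable; first exact: segment_compact.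
exact: inv_continuous_itv.
Qed.

Lemma Rintegral_inv a b : 0 < a -> a < b ->
  \int[mu]_(x in `[a, b]) x^-1 = ln b - ln a.
Proof.
move=> a0 ab; rewrite /Rintegral (@continuous_FTC2 R _ (@ln R) a b ab) //.
- exact: inv_continuous_itv.
- split.
  + move=> x; rewrite in_itv /= => /andP[ax _].
    by have [] := is_derive1_ln (lt_trans a0 ax).
  + by apply: cvg_at_right_filter; exact: continuous_ln.
  + by apply: cvg_at_left_filter; apply: continuous_ln; exact: lt_trans ab.
move=> x; rewrite in_itv /= => /andP[ax _].
by rewrite derive1E; have [_ ->] := is_derive1_ln (lt_trans a0 ax).
Qed.

(** For large [X] the integral lies between [ln X - ln x0] and [ln X]. *)
Lemma log_density_one S x0 : measurable S -> 1 <= x0 ->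
  (forall x, x0 <= x -> S x) -> has_log_density S 1.
Proof.
move=> mS x01 Sx; rewrite /has_log_density; apply/cvgrPdist_le => e e0.
near=> X.
have X0 : x0 < X by near: X; apply: nbhs_pinfty_gt; exact: num_real.
have X1 : 1 < X by exact: le_lt_trans X0.
have lX : 0 < ln X by rewrite ln_gt0.
have mX : measurable (`[1, X]%classic : set R) by exact: measurable_itv.
have mSX : measurable (`[1, X] `&` S) by exact: measurableI.
have pos x : (`[1, X]%classic : set R) x -> 0 <= x^-1.
  by rewrite /= in_itv /= => /andP[x1 _]; rewrite invr_ge0 (le_trans _ x1).
have up : \int[mu]_(x in `[1, X] `&` S) x^-1 <= ln X.
  rewrite -[leRHS]subr0 -[X in _ <= _ - X](@ln1 R) -Rintegral_inv //.
  by apply: Rintegral_subset => //; exact: inv_integrable.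
have lo : ln X - ln x0 <= \int[mu]_(x in `[1, X] `&` S) x^-1.
  rewrite -Rintegral_inv //; last exact: lt_le_trans x01.
  apply: Rintegral_subset => //.
  - move=> x /=; rewrite !in_itv /= => /andP[x0x xX]; split; last exact: Sx.
    by rewrite xX (le_trans x01).
  - eapply integrableS; [exact mX|exact mSX|exact: subIsetl|].
    exact: inv_integrable.
  - by move=> x [xX _]; exact: pos.
set J := \int[mu]_(x in _) _ in up lo *.
have -> : 1 - (ln X)^-1 * J = (ln X)^-1 * (ln X - J).
  by rewrite mulrBr mulVf // gt_eqF.
have eX : ln x0 <= e * ln X.
  rewrite mulrC -ler_pdivrMr //.
  have : expR (ln x0 / e) <= X by near: X; apply: nbhs_pinfty_ge; exact: num_real.
  by move=> h; rewrite -[leLHS](@expRK R) ler_ln ?posrE ?expR_gt0 // (lt_trans _ X1).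
rewrite ger0_norm; last by rewrite mulr_ge0 ?invr_ge0 ?subr_ge0 // ltW.
rewrite mulrC ler_pdivrMr //; apply: le_trans eX; lra.
Unshelve. all: by end_near.
Qed.

Lemma measurable_truncn S : (forall x, S x -> 1 <= x) ->
  (forall x, 1 <= x -> S x <-> S (Num.truncn x)%:R) -> measurable S.
Proof.
move=> S1 ST.
have -> : S = \bigcup_(n in [set n : nat | (0 < n)%N /\ S n%:R])
    `[n%:R, n.+1%:R[%classic.
  apply/seteqP; split=> x.
    move=> Sx; have x1 := S1 x Sx; exists (Num.truncn x).
      by split; [rewrite truncn_gt0|apply/(ST x x1)].
    by rewrite /= in_itv /=; apply: truncn_itv; exact: le_trans x1.
  move=> [n [n0 Sn]]; rewrite /= in_itv /= => /andP[nx xn].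
  have x1 : 1 <= x by apply: le_trans nx; rewrite ler1n.
  by apply/ST => //; rewrite (_ : Num.truncn x = n) //; apply/truncn_def; rewrite nx.
by apply: bigcup_measurable => n _; exact: measurable_itv.
Qed.

End LogDensity.

(** * Rings of integers: Galois action and denominators *)

Notation full_integers L := (integers (fullv : {subfield L})).

Section Integers.
Variables (L : splittingFieldType rat).
Implicit Types (K E : {subfield L}).

Lemma algint_inP K x :
  reflect (x \in K /\ integralOver (intr : int -> L) x) (x \in algint_in K).
Proof. by apply: (iffP andP) => -[Kx /asboolP]. Qed.

Definition mkint K x (Kx : x \in K) (Ix : integralOver (intr : int -> L) x) :
  integers K := Integers (introT (algint_inP K x) (conj Kx Ix)).

Lemma ival_in K (x : integers K) : integer_val x \in K.
Proof. by have /algint_inP[] := integer_valP x. Qed.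

Lemma ival_integral K (x : integers K) :
  integralOver (intr : int -> L) (integer_val x).
Proof. by have /algint_inP[] := integer_valP x. Qed.

Lemma ival_inj K : injective (@integer_val L K).
Proof. exact: val_inj. Qed.

Lemma ivalD K (x y : integers K) :
  integer_val (x + y) = integer_val x + integer_val y.
Proof. by []. Qed.

Lemma ivalB K (x y : integers K) :
  integer_val (x - y) = integer_val x - integer_val y.
Proof. by []. Qed.

Lemma ivalN K (x : integers K) : integer_val (- x) = - integer_val x.
Proof. by []. Qed.

Lemma ivalM K (x y : integers K) :
  integer_val (x * y) = integer_val x * integer_val y.
Proof. by []. Qed.

Lemma ival1 K : integer_val (1 : integers K) = 1.
Proof. by []. Qed.

Lemma ivalX K (x : integers K) n : integer_val (x ^+ n) = integer_val x ^+ n.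
Proof. by elim: n => // n IH; rewrite !exprS -IH. Qed.

Lemma ival_nat K n : integer_val (n%:R : integers K) = n%:R.
Proof. by elim: n => // n IH; rewrite !mulrSr -IH. Qed.

Lemma ival_int K (n : int) : integer_val (n%:~R : integers K) = n%:~R.
Proof. by case: n => n; rewrite ?NegzE ?rmorphN /= ?ivalN ival_nat. Qed.

Definition ivalE := (ivalX, ival_nat, ivalD, ivalB, ivalN, ivalM, ival1).

Definition incl K (x : integers K) : full_integers L :=
  mkint (memvf (integer_val x)) (ival_integral x).

Lemma incl_zmod K : zmod_morphism (@incl K).
Proof. by move=> x y; apply: ival_inj. Qed.
Lemma incl_monoid K : monoid_morphism (@incl K).
Proof. by split=> [|x y]; apply: ival_inj. Qed.
HB.instance Definition _ K :=
  GRing.isZmodMorphism.Build _ _ (@incl K) (@incl_zmod K).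
HB.instance Definition _ K :=
  GRing.isMonoidMorphism.Build _ _ (@incl K) (@incl_monoid K).

Lemma incl_inj K : injective (@incl K).
Proof. by move=> x y /(congr1 (@integer_val _ _)) h; apply: ival_inj. Qed.

Lemma act_integral (s : gal_of (fullv : {subfield L})) (x : full_integers L) :
  integralOver (intr : int -> L) (s (integer_val x)).
Proof.
have := integral_rmorph s (ival_integral x).
case=> f mf rf; exists f => //; congr (root _ _): rf; apply: eq_map_poly => n /=.
by rewrite rmorph_int.
Qed.

Definition act s (x : full_integers L) : full_integers L :=
  mkint (memvf _) (act_integral s x).

Lemma act_zmod s : zmod_morphism (act s).
Proof. by move=> x y; apply: ival_inj; rewrite /= -rmorphB. Qed.
Lemma act_monoid s : monoid_morphism (act s).
Proof.
by split=> [|x y]; apply: ival_inj; rewrite /= ?rmorph1 -?rmorphM.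
Qed.
HB.instance Definition _ s :=
  GRing.isZmodMorphism.Build _ _ (act s) (@act_zmod s).
HB.instance Definition _ s :=
  GRing.isMonoidMorphism.Build _ _ (act s) (@act_monoid s).

Lemma actE s x : integer_val (act s x) = s (integer_val x).
Proof. by []. Qed.

Lemma galois_fullv K : galois K (fullv : {subfield L}).
Proof.
apply/and3P; split; first exact: subvf; last exact: normalFieldf.
apply/separableP => y _; apply: pcharf0_separable => p.
by rewrite pchar_lalg pchar_num.
Qed.

Lemma gal_fixed_in K x :
  (forall s : gal_of (fullv : {subfield L}), s \in 'Gal(fullv / K)%g -> s x = x)
  -> x \in K.
Proof.
move=> h; rewrite -(galois_fixedField (galois_fullv K)).
by apply/fixedFieldP; first exact: memvf.
Qed.

Lemma gal_move E x :
  x \notin E -> exists2 s : gal_of (fullv : {subfield L}),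
    s \in 'Gal(fullv / E)%g & s x != x.
Proof.
move=> xE; apply: contrapT => h1; move/negP: xE; apply.
apply: gal_fixed_in => s sE.
by apply/eqP/negPn/negP => sg; apply: h1; exists s.
Qed.

Lemma gal_fix E (s : gal_of (fullv : {subfield L})) x :
  s \in 'Gal(fullv / E)%g -> x \in E -> s x = x.
Proof. by move=> sE; apply: fixed_gal sE; exact: subvf. Qed.

Lemma gal_opp (s : gal_of (fullv : {subfield L})) x :
  s (x ^+ 2) = x ^+ 2 -> s x != x -> s x = - x.
Proof.
rewrite rmorphXn => /eqP; rewrite eqf_sqr => /orP[/eqP->|/eqP //].
by rewrite eqxx.
Qed.

(** Split a polynomial expression in [x] into its even and odd parts. *)
Lemma Fadjoin_sqr E x z : x ^+ 2 \in E -> z \in <<E; x>>%VS ->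
  exists c d, [/\ c \in E, d \in E & z = c + d * x].
Proof.
move=> xE /Fadjoin_polyP[f fE ->]; rewrite -[f]poly_even_odd.
exists (even_poly f).[x ^+ 2], (odd_poly f).[x ^+ 2].
rewrite !hornerE !horner_comp !hornerE; split=> //.
  apply: rpred_horner => //; apply/polyOverP => i.
  by rewrite coef_even_poly (polyOverP fE).
apply: rpred_horner => //; apply/polyOverP => i.
by rewrite coef_odd_poly (polyOverP fE).
Qed.

End Integers.

Definition subring_set (A : nzRingType) (T : set A) :=
  [/\ T 1, forall x y, T x -> T y -> T (x - y)
         & forall x y, T x -> T y -> T (x * y)].

Section SubringSet.
Variables (A : nzRingType) (T : set A).
Hypothesis sT : subring_set T.

Lemma subring_setB x y : T x -> T y -> T (x - y).
Proof. by case: sT => ? h ?; exact: h. Qed.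
Lemma subring_setM x y : T x -> T y -> T (x * y).
Proof. by case: sT => ? ? h; exact: h. Qed.
Lemma subring_set1 : T 1. Proof. by case: sT. Qed.
Lemma subring_set0 : T 0.
Proof. by rewrite -(subrr 1); apply: subring_setB; exact: subring_set1. Qed.
Lemma subring_setN x : T x -> T (- x).
Proof. by rewrite -sub0r; apply: subring_setB; exact: subring_set0. Qed.
Lemma subring_setD x y : T x -> T y -> T (x + y).
Proof. by move=> Tx /subring_setN Ty; rewrite -[y]opprK; exact: subring_setB. Qed.
Lemma subring_set_nat n : T n%:R.
Proof.
elim: n => [|n IH]; first exact: subring_set0.
by rewrite mulrSr; apply: subring_setD => //; exact: subring_set1.
Qed.
Lemma subring_set_int (n : int) : T n%:~R.
Proof.
case: n => n; first exact: subring_set_nat.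
by rewrite NegzE rmorphN; apply: subring_setN; exact: subring_set_nat.
Qed.
End SubringSet.

Section Tower.
Variables (L : splittingFieldType rat) (LC : {rmorphism L -> algC}).

(** Transported to the algebraic numbers, where rational algebraic integers
    are known to be integers. *)
Lemma rational_integer (x : L) : x \in 1%VS ->
  integralOver (intr : int -> L) x -> exists n : int, x = n%:~R.
Proof.
case/vlineP=> r er [f mf rf].
have Ax : LC x \in Aint.
  apply: (@root_monic_Aint (map_poly intr f)).
  - have : root (map_poly LC (map_poly intr f)) (LC x) by rewrite rmorph_root.
    rewrite -map_poly_comp; congr root; apply: eq_map_poly => n /=.
    by rewrite rmorph_int.
  - by rewrite monic_map.
  - by apply/polyOverP => j; rewrite coef_map /=; exact: intr_int.
have Rx : LC x \in Crat.
  rewrite er.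
  have /= -> := fmorph_eq_rat (LC \o in_alg L) r; rewrite ?er.
  by apply/CratP; exists r.
have /intrP[n en] := Cint_rat_Aint Rx Ax.
by exists n; apply: (fmorph_inj LC); rewrite en rmorph_int.
Qed.

Variable T : set (full_integers L).
Hypothesis sT : subring_set T.

(** [T] stands for an order given by generators: [covers E d] says that [d]
    is a common denominator over [T] for the integers of [E]. *)
Definition covers (E : {subfield L}) d :=
  forall z : full_integers L, integer_val z \in E -> T (d%:R * z).

Lemma covers1 : covers 1%AS 1.
Proof.
move=> z z1; have [n en] := rational_integer z1 (ival_integral z).
have -> : z = n%:~R by apply: ival_inj; rewrite en ival_int.
by rewrite mul1r; exact: subring_set_int.
Qed.

(** The denominators of the integers of a quadratic extension [E(g)] over
    [E + E g] divide [2 g ^ 2], by taking traces of [z] and of [g z]. *)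
Lemma covers_quadratic (E : {subfield L}) d (g h : full_integers L) M :
  covers E d -> T g -> T h -> integer_val g ^+ 2 \in E ->
  h * g ^+ 2 = M%:R -> covers <<E; integer_val g>>%AS (2 * M * d).
Proof.
move=> cE Tg Th gE hg z zE; rewrite natrM -mulrA; set dz := d%:R * z.
have Tn n x : T x -> T (n%:R * x).
  by apply: subring_setM => //; exact: subring_set_nat.
have [gE'|gnE] := boolP (integer_val g \in E).
  apply: (Tn); apply: cE.
  have [c [e [cE' eE ->]]] := Fadjoin_sqr gE zE.
  by rewrite rpredD // rpredM.
have [s sE sg] := gal_move gnE.
have fx y : y \in E -> s y = y by exact: gal_fix.
have {}sg : s (integer_val g) = - integer_val g by apply: gal_opp => //; exact: fx.
have [c [e [cE' eE ez]]] := Fadjoin_sqr gE zE.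
have sz : s (integer_val z) = c - e * integer_val g.
  by rewrite ez rmorphD rmorphM /= sg !fx // mulrN.
have E1 : integer_val (z + act s z) \in E.
  by rewrite ivalD actE sz ez addrACA subrr addr0 rpredD.
have E2 : integer_val (g * (z - act s z)) \in E.
  rewrite ivalM ivalB actE sz ez; set x := integer_val g in gE *.
  have -> : x * (c + e * x - (c - e * x)) = (e * x ^+ 2) *+ 2 by ring.
  by rewrite rpredMn // rpredM.
have -> : (2 * M)%:R * dz = M%:R * (d%:R * (z + act s z))
   + h * g * (d%:R * (g * (z - act s z))).
  rewrite natrM -hg /dz; ring.
apply: subring_setD => //; first by apply: (Tn); exact: cE.
by apply: subring_setM => //; [exact: subring_setM|exact: cE].
Qed.
End Tower.

(** * Squares of rational and Gaussian numbers *)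

Section RationalSquares.

Lemma rat_sqr_nat (r : rat) n : r ^+ 2 = n%:R -> exists m : nat, n = (m ^ 2)%N.
Proof.
move=> rn.
have Ar : (ratr r : algC) \in Aint.
  apply: (@root_monic_Aint ('X^2 - n%:R%:P)).
  - by rewrite rootE !hornerE -rmorphXn rn /= rmorph_nat subrr.
  - by rewrite monicXnsubC.
  - apply/polyOverP => j; rewrite coefB coefXn coefC.
    by apply: rpredB; [exact: rpred_nat|case: ifP => _; rewrite ?rpred0 ?rpred_nat].
have /intrP[m em] : (ratr r : algC) \in Num.int.
  by apply: Cint_rat_Aint => //; apply/CratP; exists r.
exists `|m|%N; apply/eqP; rewrite -(eqr_nat algC) natrX natr_absz.
rewrite -[(n%:R : algC)](rmorph_nat (@ratr algC)) -rn rmorphXn /= em.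
rewrite -!rmorphXn /=; apply/eqP; congr (_%:~R).
by rewrite [in RHS]expr2 PoszM abszE -expr2 real_normK ?num_real.
Qed.

Lemma rat_sqr_neq2 (r : rat) : r ^+ 2 <> 2.
Proof.
move=> /(@rat_sqr_nat _ 2)[m]; case: m => [|[|m]] //.
by rewrite -(addn2 m) sqrnD; lia.
Qed.

(** This is the form in which the norm of a Gaussian square shows up. *)
Lemma rat_sqr_sum_neq (r x y : rat) n : n != 0%N ->
  (x ^+ 2 + y ^+ 2) ^+ 2 <> 2 * (n%:R) ^+ 2.
Proof.
move=> n0 e; apply: (@rat_sqr_neq2 ((x ^+ 2 + y ^+ 2) / n%:R)).
by rewrite expr_div_n e mulfK // sqrf_eq0 pnatr_eq0.
Qed.

End RationalSquares.

Section Gaussian.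
Variables (L : splittingFieldType rat) (i : L).
Hypothesis i2 : i ^+ 2 = -1.

Lemma i_notin1 : i \notin 1%VS.
Proof.
apply/negP => /vlineP[r er]; move: i2; rewrite er exprZn expr1n => h.
have : (r ^+ 2 + 1) *: (1 : L) = 0 by rewrite scalerDl h scale1r addNr.
move/eqP; rewrite scaler_eq0 oner_eq0 orbF; apply/negP.
by rewrite gt_eqF // ltr_wpDl // sqr_ge0.
Qed.

Lemma gaussP z : z \in <<1; i>>%VS ->
  exists c d : rat, z = c%:A + d%:A * i.
Proof.
have i2' : i ^+ 2 \in 1%AS by rewrite i2 rpredN mem1v.
case/(Fadjoin_sqr i2') => c [d [/vlineP[c' ->] /vlineP[d' ->] ->]].
by exists c', d'.
Qed.

Lemma gauss_inj (c d c' d' : rat) :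
  c%:A + d%:A * i = c'%:A + d'%:A * i -> c = c' /\ d = d'.
Proof.
move=> e; have e' : (d - d')%:A * i = (c' - c)%:A.
  by rewrite !scalerBl mulrBl; move/eqP: e; rewrite -subr_eq0 => /eqP e; 
     apply/eqP; rewrite -subr_eq0 -[X in _ == X]e; apply/eqP; ring.
have [dd|dd] := eqVneq (d - d') 0.
  move: e'; rewrite dd scale0r mul0r => /esym/eqP.
  rewrite scaler_eq0 oner_eq0 orbF => /eqP cc; split; lra.
have := i_notin1; have -> : i = ((d - d')^-1 * (c' - c))%:A.
  by rewrite -scalerA -e' -scalerAl mul1r scalerA mulVf // scale1r.
by rewrite rpredZ // mem1v.
Qed.

Lemma gauss_sqr (c d : rat) : (c%:A + d%:A * i) ^+ 2 =
  (c ^+ 2 - d ^+ 2)%:A + (2 * c * d)%:A * i.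
Proof.
have gen (f : {rmorphism rat -> L}) : (f c + f d * i) ^+ 2 =
    f (c ^+ 2 - d ^+ 2) + f (2 * c * d) * i.
  by rewrite rmorphB 2!rmorphXn !rmorphM rmorph_nat sqrrD exprMn i2; ring.
exact: (gen (in_alg L)).
Qed.

Lemma gauss_sqr_neq z (x y : rat) n : n != 0%N -> z \in <<1; i>>%VS ->
  x ^+ 2 + y ^+ 2 = 2 * n%:R ^+ 2 -> z ^+ 2 <> x%:A + y%:A * i.
Proof.
move=> n0 /gaussP[c [d ->]] xy; rewrite gauss_sqr => /gauss_inj[e1 e2].
apply: (@rat_sqr_sum_neq 0 c d n n0); rewrite -xy -e1 -e2; ring.
Qed.

Lemma gauss_sqr_neqi z : z \in <<1; i>>%VS -> z ^+ 2 <> i.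
Proof.
move=> /gaussP[c [d ->]] e.
have : (c%:A + d%:A * i) ^+ 2 = 0%:A + 1%:A * i.
  by rewrite e scale0r scale1r mul1r add0r.
rewrite gauss_sqr => /gauss_inj[e1 e2] {e}.
have /eqP : c ^+ 2 = d ^+ 2 by lra.
rewrite eqf_sqr => /orP[/eqP cd|/eqP cd]; last by nra.
by apply: (@rat_sqr_neq2 (2 * c)); move: e2; rewrite cd => e2; nra.
Qed.

End Gaussian.

(** * The field generated by two conjugate fourth roots *)

(** The complex embedding [bq_C] serves to recognize rational integers and to
    see that the characteristic is 0. *)
Record biquartic (q : nat) := Biquartic {
  bq_field : splittingFieldType rat;
  bq_C : {rmorphism bq_field -> algC};
  bq_i : bq_field;
  bq_A : bq_field;
  bq_B : bq_field;
  bq_q0 : q != 0%N;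
  bq_i2 : bq_i ^+ 2 = -1;
  bq_A4 : bq_A ^+ 4 = q%:R * (1 + bq_i);
  bq_B4 : bq_B ^+ 4 = q%:R * (1 - bq_i);
  bq_gen : <<<<<<1; bq_i>>; bq_A>>; bq_B>>%VS = fullv }.

Section Biquartic.
Variables (q : nat) (S : biquartic q).
Notation L := (bq_field S).
Notation LC := (bq_C S).
Notation i := (bq_i S).
Notation A := (bq_A S).
Notation B := (bq_B S).
Notation G := (gal_of (fullv : {subfield L})).
Let i2 := bq_i2 S.
Let A4 := bq_A4 S.
Let B4 := bq_B4 S.

Definition bq_base : {subfield L} := <<<<1; i>>; B ^+ 2>>%AS.
Notation K := bq_base.

Lemma root_integral (x : L) n : (0 < n)%N ->
  integralOver (intr : int -> L) (x ^+ n) -> integralOver (intr : int -> L) x.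
Proof.
move=> n0 Ix; apply: (@integral_root_monic _ _ _ _ ('X^n - (x ^+ n)%:P)).
- exact: monicXnsubC.
- by rewrite rootE !hornerE subrr.
- apply/integral_poly => j; rewrite coefB coefXn coefC; apply: integral_sub.
    exact: integral_nat.
  by case: ifP => _; [exact: Ix|exact: mxpoly.integral0].
Qed.

Lemma i_integral : integralOver (intr : int -> L) i.
Proof.
by apply: (@root_integral _ 2) => //; rewrite i2; apply/integral_opp/integral1.
Qed.

Lemma A_integral : integralOver (intr : int -> L) A.
Proof.
apply: (@root_integral _ 4) => //; rewrite A4; apply: integral_mul.
  exact: integral_nat.
by apply: integral_add; [exact: integral1|exact: i_integral].
Qed.

Lemma B_integral : integralOver (intr : int -> L) B.
Proof.
apply: (@root_integral _ 4) => //; rewrite B4; apply: integral_mul.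
  exact: integral_nat.
by apply: integral_sub; [exact: integral1|exact: i_integral].
Qed.

Definition iO : full_integers L := mkint (memvf i) i_integral.
Definition AO : full_integers L := mkint (memvf A) A_integral.
Definition BO : full_integers L := mkint (memvf B) B_integral.

Lemma iO2 : iO ^+ 2 = -1.
Proof. by apply: ival_inj; rewrite !ivalE /= i2. Qed.
Lemma AO4 : AO ^+ 4 = q%:R * (1 + iO).
Proof. by apply: ival_inj; rewrite !ivalE /= A4. Qed.
Lemma BO4 : BO ^+ 4 = q%:R * (1 - iO).
Proof. by apply: ival_inj; rewrite !ivalE /= B4. Qed.

Lemma AB4 : AO ^+ 4 * BO ^+ 4 = (2 * q ^ 2)%:R.
Proof.
rewrite AO4 BO4 natrM natrX.
transitivity (q%:R ^+ 2 * (1 - iO ^+ 2)); first by ring.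
by rewrite iO2; ring.
Qed.

Lemma i_inK : i \in K.
Proof. by apply: subvP_adjoin; exact: memv_adjoin. Qed.
Lemma B2_inK : B ^+ 2 \in K. Proof. exact: memv_adjoin. Qed.
Lemma A4_inK : A ^+ 4 \in K.
Proof. by rewrite A4 rpredM ?rpred_nat ?rpredD ?mem1v ?i_inK. Qed.
Lemma B4_inK : B ^+ 4 \in K.
Proof. by rewrite (exprM B 2 2) rpredX // B2_inK. Qed.

Definition bdenom := ((4 * q ^ 2) ^ 5)%N.

Section Covers.
Variable T : set (full_integers L).
Hypothesis sT : subring_set T.

Lemma covers_i : T iO -> covers T <<1; i>>%AS (2 * (2 * q ^ 2)).
Proof.
move=> Ti; rewrite -[(2 * _)%N]muln1.
apply: (@covers_quadratic _ _ sT 1%AS 1 iO (- (2 * q ^ 2)%:R)) => //.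
- exact: (covers1 LC sT).
- by apply: subring_setN => //; exact: subring_set_nat.
- by rewrite /= i2 rpredN mem1v.
- by rewrite iO2 mulrNN mulr1.
Qed.

Lemma covers_base : T iO -> T (BO ^+ 2) -> covers T K ((4 * q ^ 2) ^ 2).
Proof.
move=> Ti TB.
rewrite (_ : _ ^ 2 = 2 * (2 * q ^ 2) * (2 * (2 * q ^ 2)))%N; last by lia.
apply: (@covers_quadratic _ _ sT <<1; i>>%AS _ (BO ^+ 2) (AO ^+ 4)) => //.
- exact: covers_i.
- rewrite AO4; apply: subring_setM => //; first exact: subring_set_nat.
  by apply: subring_setD => //; exact: subring_set1.
- rewrite ivalX -exprM [X in X \in _]B4 rpredM ?rpred_nat ?rpredB ?mem1v //.
  exact: memv_adjoin.
- by rewrite -exprM AB4.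
Qed.

(** The tower of square roots [i], [B ^ 2], [A ^ 2], [A], [B], each step
    contributing a factor [2 (2 q ^ 2)] because the square of each generator
    divides [2 q ^ 2] in [T]. *)
Lemma covers_full : T iO -> T AO -> T BO -> forall z, T (bdenom%:R * z).
Proof.
move=> Ti TA TB z; have TX x n : T x -> T (x ^+ n).
  move=> Tx; elim: n => [|n IH]; first exact: subring_set1.
  by rewrite exprS; exact: subring_setM.
have TM := subring_setM sT.
pose M := (2 * q ^ 2)%N; rewrite /bdenom.
rewrite (_ : _ ^ 5 = 2 * M * (2 * M * (2 * M * (4 * q ^ 2) ^ 2)))%N;
  last by rewrite /M; lia.
pose E3 := <<K; A ^+ 2>>%AS; pose E4 := <<E3; A>>%AS.
have c3 : covers T E3 (2 * M * (4 * q ^ 2) ^ 2).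
  apply: (@covers_quadratic _ _ sT K _ (AO ^+ 2) (BO ^+ 4)); auto.
  - by apply: covers_base; auto.
  - by rewrite ivalX -exprM A4_inK.
  - by rewrite -exprM mulrC AB4.
have c4 : covers T E4 (2 * M * (2 * M * (4 * q ^ 2) ^ 2)).
  apply: (@covers_quadratic _ _ sT E3 _ AO (AO ^+ 2 * BO ^+ 4)); auto.
  - exact: memv_adjoin.
  - by rewrite mulrAC -exprD AB4.
have c5 : covers T <<E4; B>>%AS (2 * M * (2 * M * (2 * M * (4 * q ^ 2) ^ 2))).
  apply: (@covers_quadratic _ _ sT E4 _ BO (BO ^+ 2 * AO ^+ 4)); auto.
  - by apply: subvP_adjoin; apply: subvP_adjoin; exact: B2_inK.
  - by rewrite mulrAC -exprD mulrC AB4.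
apply: c5; have : integer_val z \in (fullv : {vspace L}) := memvf _.
rewrite -(bq_gen S); apply/subvP.
apply/FadjoinP; split; last exact: memv_adjoin.
apply/FadjoinP; split; last by apply: subvP_adjoin; exact: memv_adjoin.
apply/FadjoinP; split; first exact: sub1v.
by apply: subvP_adjoin; apply: subvP_adjoin; apply: subvP_adjoin; exact: i_inK.
Qed.

End Covers.

(** The fixed field of [s * t^-1] contains the generators. *)
Lemma gal_ext (s t : G) : s i = t i -> s A = t A -> s B = t B -> s = t.
Proof.
move=> ei eA eB; apply/eqP/gal_eqP => z _.
have : (s * t^-1)%g z = z.
  have /fixedFieldP : z \in fixedField [set (s * t^-1)%g]%SET.
    have : z \in (fullv : {vspace L}) := memvf _.
    have fx x : s x = t x -> x \in fixedField [set (s * t^-1)%g]%SET.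
      move=> e; apply/fixedFieldP; first exact: memvf.
      move=> u /set1P ->; rewrite galM ?memvf // e.
      by rewrite -galM ?memvf // mulgV gal_id.
    rewrite -(bq_gen S); apply/subvP.
    apply/FadjoinP; split; last exact: fx.
    apply/FadjoinP; split; last exact: fx.
    by apply/FadjoinP; split; [exact: sub1v|exact: fx].
  by move=> /(_ (memvf _)) -> //; exact: set11.
rewrite galM ?memvf // => e.
by rewrite -[in RHS]e -galM ?memvf // mulVg gal_id.
Qed.

Lemma galK_fix (s : G) :
  s \in 'Gal(fullv / K)%g <-> s i = i /\ s (B ^+ 2) = B ^+ 2.
Proof.
split=> [sK|[si sB]].
  by split; apply: (gal_fix sK); [exact: i_inK|exact: B2_inK].
have h := @galois_connection _ L K (fullv : {subfield L}) [set s]%SET (subvf K).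
have : ([set s]%SET \subset 'Gal(fullv / K)%g).
  rewrite h.
  have fx x : s x = x -> x \in fixedField [set s]%SET.
    by move=> e; apply/fixedFieldP; [exact: memvf|move=> u /set1P ->].
  apply/FadjoinP; split; last exact: fx.
  by apply/FadjoinP; split; [exact: sub1v|exact: fx].
by rewrite finset.sub1set.
Qed.

End Biquartic.

(** * Its automorphisms *)

Section BiquarticGalois.
Variables (q : nat) (S : biquartic q).
Notation L := (bq_field S).
Notation i := (bq_i S).
Notation A := (bq_A S).
Notation B := (bq_B S).
Notation K := (bq_base S).
Notation G := (gal_of (fullv : {subfield L})).
Let i2 := bq_i2 S.
Let A4 := bq_A4 S.
Let B4 := bq_B4 S.
Let q0 := bq_q0 S.

Lemma gal_exp (s : G) x n : s (x ^+ n) = s x ^+ n. Proof. exact: rmorphXn. Qed.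
Lemma gal_mul (s : G) x y : s (x * y) = s x * s y. Proof. exact: rmorphM. Qed.
Lemma gal_add (s : G) x y : s (x + y) = s x + s y. Proof. exact: rmorphD. Qed.
Lemma gal_sub (s : G) x y : s (x - y) = s x - s y. Proof. exact: rmorphB. Qed.
Lemma gal_neg (s : G) x : s (- x) = - s x. Proof. exact: rmorphN. Qed.
Lemma gal1 (s : G) : s 1 = 1. Proof. exact: rmorph1. Qed.
Lemma gal_nat (s : G) n : s n%:R = n%:R. Proof. exact: rmorph_nat. Qed.

Lemma natr_bq_eq0 n : (n%:R == 0 :> L) = (n == 0%N).
Proof. by rewrite -(fmorph_eq0 (bq_C S)) rmorph_nat pnatr_eq0. Qed.

Lemma swap_exists : exists t : G, t i = - i.
Proof.
have [s _ si] := gal_move (i_notin1 i2 : i \notin (1%AS : {subfield L})).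
by exists s; apply: gal_opp => //; rewrite i2 gal_neg gal1.
Qed.

Lemma gaussian_A4 : A ^+ 4 = q%:R%:A + q%:R%:A * i.
Proof. by rewrite A4 scaler_nat mulrDr mulr1. Qed.

Lemma gaussian_B4 : B ^+ 4 = q%:R%:A + (- q%:R)%:A * i.
Proof. by rewrite B4 scaleNr scaler_nat mulrBr mulr1 mulNr. Qed.

Lemma A4B4 : A ^+ 4 = i * B ^+ 4.
Proof. by rewrite A4 B4 mulrCA mulrBr -expr2 i2 opprK mulr1 [i + 1]addrC. Qed.

Lemma A_neq0 : A != 0.
Proof.
apply/eqP => A0; apply: (gauss_sqr_neq (x := q%:R) (y := q%:R) i2 q0 (mem0v _)).
  by ring.
by rewrite -gaussian_A4 A0 !expr0n.
Qed.

Lemma B_neq0 : B != 0.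
Proof.
apply: contra A_neq0 => /eqP B0; have : A ^+ 4 == 0.
  by rewrite A4B4 B0 expr0n mulr0.
by rewrite expf_eq0.
Qed.

Lemma B2_notin_gauss : B ^+ 2 \notin <<1; i>>%VS.
Proof.
apply/negP => h.
apply: (gauss_sqr_neq (x := q%:R) (y := - q%:R) i2 q0 h); first by ring.
by rewrite -exprM gaussian_B4.
Qed.

(** If [A ^ 2 = c + d B ^ 2] lay in [K], then [q (1 + i)] would be [c ^ 2], or
    [d ^ 2] times [q (1 - i)], in the Gaussian field.  The first has norm
    [2 q ^ 2], which is not a rational square, and the second makes [i] a
    Gaussian square. *)
Lemma A2_notin_base : A ^+ 2 \notin K.
Proof.
apply/negP => h; have b2 : (B ^+ 2) ^+ 2 \in <<1; i>>%AS.
  by rewrite -exprM [X in X \in _]B4 rpredM ?rpred_nat ?rpredB ?mem1v ?memv_adjoin.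
have [c [d [cE dE e]]] := Fadjoin_sqr b2 h.
have aE : A ^+ 4 \in <<1; i>>%VS.
  by rewrite A4 rpredM ?rpred_nat ?rpredD ?mem1v ?memv_adjoin.
have ea : A ^+ 4 = c ^+ 2 + d ^+ 2 * (B ^+ 2) ^+ 2 + 2 * c * d * B ^+ 2.
  by rewrite (exprM A 2 2) e; ring.
have [cd|cd] := eqVneq (2 * c * d) 0.
  move: cd => /eqP; rewrite !mulf_eq0 natr_bq_eq0 /= => /orP[]/eqP z0.
    apply: (gauss_sqr_neqi i2 dE); apply: (mulIf (expf_neq0 4 B_neq0)).
    by rewrite -A4B4 ea z0; ring.
  apply: (gauss_sqr_neq (x := q%:R) (y := q%:R) i2 q0 cE); first by ring.
  by rewrite -gaussian_A4 ea z0; ring.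
move/negP: B2_notin_gauss; apply.
have -> : B ^+ 2 = (A ^+ 4 - (c ^+ 2 + d ^+ 2 * (B ^+ 2) ^+ 2)) / (2 * c * d).
  by apply: (mulfI cd); rewrite mulrC [RHS]mulrC divfK // ea; ring.
change (is_true ((A ^+ 4 - (c ^+ 2 + d ^+ 2 * (B ^+ 2) ^+ 2)) / (2 * c * d)
  \in (<<1; i>>%AS : {subfield L}))).
apply: rpred_div; first apply: rpredB => //.
  by apply: rpredD; [exact: rpredX|apply: rpredM => //; exact: rpredX].
by apply: rpredM => //; apply: rpredM => //; exact: rpred_nat.
Qed.

Lemma flip_exists : exists2 h : G, h \in 'Gal(fullv / K)%g & h (A ^+ 2) = - A ^+ 2.
Proof.
have [h hK hA] := gal_move A2_notin_base; exists h => //.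
by apply: gal_opp hA; rewrite -exprM (gal_fix hK) // A4_inK.
Qed.

(** An automorphism over [K] which negates [A ^ 2] multiplies [A] by [i] or
    [- i] and [B] by 1 or [- 1]; its square is the one sought. *)
Lemma bq_X_exists : exists X : G, [/\ X i = i, X A = - A & X B = B].
Proof.
have [h hK hA2] := flip_exists; have [hi hB2] := (galK_fix h).1 hK.
exists (h * h)%g; rewrite !galM ?memvf //; split; first by rewrite !hi.
  have : h A ^+ 2 = (i * A) ^+ 2 by rewrite -gal_exp hA2 exprMn i2 mulN1r.
  case/sqr_eq_cases => e; rewrite e ?gal_neg gal_mul hi e.
    by rewrite mulrA -expr2 i2 mulN1r.
  by rewrite mulrN opprK mulrA -expr2 i2 mulN1r.
have : h B ^+ 2 = B ^+ 2 by rewrite -gal_exp.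
by case/sqr_eq_cases => e; rewrite e ?gal_neg e ?opprK.
Qed.

Lemma swap_root (t : G) : t i = - i ->
  (exists n, t A = i ^+ n * B) /\ (exists n, t B = i ^+ n * A).
Proof.
move=> ti; split; apply: (fourth_eq_cases i2); rewrite -gal_exp.
  by rewrite A4 gal_mul gal_nat gal_add gal1 ti B4.
by rewrite B4 gal_mul gal_nat gal_sub gal1 ti opprK A4.
Qed.

Lemma galV_i (t : G) : t i = - i -> (t^-1)%g i = - i.
Proof.
move=> ti; apply: (fmorph_inj t).
by rewrite /= -galM ?memvf // mulVg gal_id gal_neg ti opprK.
Qed.

(** The conjugate of the previous automorphism by one which negates [i]. *)
Lemma bq_Y_exists : exists Y : G, [/\ Y i = i, Y A = A & Y B = - B].
Proof.
have [t ti] := swap_exists; have [X [Xi XA XB]] := bq_X_exists.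
have [[n tA] [m tB]] := swap_root (galV_i ti).
have Xn k : X (i ^+ k) = i ^+ k by rewrite gal_exp Xi.
exists (t^-1 * X * t)%g; rewrite !galM ?memvf //.
have tV x : t ((t^-1)%g x) = x by rewrite -galM ?memvf // mulVg gal_id.
split; first by rewrite (galV_i ti) gal_neg Xi -(galV_i ti) tV.
  by rewrite tA gal_mul Xn XB -tA tV.
by rewrite tB gal_mul Xn XA mulrN -tB gal_neg tV.
Qed.

Definition bq_X : G := projT1 (cid bq_X_exists).
Definition bq_Y : G := projT1 (cid bq_Y_exists).
Notation X := bq_X.
Notation Y := bq_Y.

Lemma bq_XP : [/\ X i = i, X A = - A & X B = B].
Proof. exact: projT2 (cid bq_X_exists). Qed.
Lemma bq_YP : [/\ Y i = i, Y A = A & Y B = - B].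
Proof. exact: projT2 (cid bq_Y_exists). Qed.

Lemma bq_X_inG : X \in 'Gal(fullv / K)%g.
Proof. by have [Xi _ XB] := bq_XP; apply/galK_fix; rewrite gal_exp XB. Qed.
Lemma bq_Y_inG : Y \in 'Gal(fullv / K)%g.
Proof. by have [Yi _ YB] := bq_YP; apply/galK_fix; rewrite gal_exp YB sqrrN. Qed.

Lemma galK_root (s : G) : s \in 'Gal(fullv / K)%g ->
  [/\ s i = i, exists n, s A = i ^+ n * A & exists n, s B = i ^+ n * B].
Proof.
move=> sK; have [si _] := (galK_fix s).1 sK; split=> //.
  by apply: (fourth_eq_cases i2); rewrite -gal_exp (gal_fix sK) ?A4_inK.
by apply: (fourth_eq_cases i2); rewrite -gal_exp (gal_fix sK) ?B4_inK.
Qed.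

Lemma swap_conj (g : G) : g i = - i -> forall z, g (Y z) = X (g z).
Proof.
move=> gi z; have [Xi XA XB] := bq_XP; have [Yi YA YB] := bq_YP.
have [[n gA] [m gB]] := swap_root gi.
have Xn k : X (i ^+ k) = i ^+ k by rewrite gal_exp Xi.
suff e : (Y * g = g * X)%g by rewrite -!galM ?memvf // e.
apply: gal_ext; rewrite !galM ?memvf //.
- by rewrite Yi gi gal_neg Xi.
- by rewrite YA gA gal_mul Xn XB.
- by rewrite YB gal_neg gB gal_mul Xn XA mulrN.
Qed.

(** Composing with an automorphism over [K] which negates [A ^ 2] changes the
    sign.  Both signs are needed to prescribe the residue of [B ^ 2]. *)
Lemma swap_sign (b : bool) :
  exists2 g : G, g i = - i & g (B ^+ 2) = (-1) ^+ b * A ^+ 2.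
Proof.
have [t ti] := swap_exists; have [h hK hA] := flip_exists.
have [hi _ _] := galK_root hK.
have : t (B ^+ 2) ^+ 2 = (A ^+ 2) ^+ 2.
  rewrite -gal_exp -!exprM B4 A4 gal_mul gal_nat gal_sub gal1 ti.
  by rewrite opprK.
have thi : (t * h)%g i = - i by rewrite galM ?memvf // ti gal_neg hi.
by case/sqr_eq_cases => e; case: b;
  [exists (t * h)%g|exists t|exists t|exists (t * h)%g] => //;
  rewrite ?galM ?memvf // e ?gal_neg ?hA ?expr1 ?mulN1r ?mul1r ?opprK.
Qed.

(** [Gal(L / K)] acts on [i], [A], [B] by multiplication with powers of [i], so
    it is abelian. *)
Lemma central_class (Z : G) : Z \in 'Gal(fullv / K)%g ->
  [set Z]%SET \in classes 'Gal(fullv / K)%g.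
Proof.
move=> ZK; have [Zi [n ZA] [m ZB]] := galK_root ZK.
suff /cent_classP <- : Z \in 'C('Gal(fullv / K))%g by apply: mem_classes.
apply/centP => s sK; have [si [n' sA] [m' sB]] := galK_root sK.
have sn k : s (i ^+ k) = i ^+ k by rewrite gal_exp si.
have Zn k : Z (i ^+ k) = i ^+ k by rewrite gal_exp Zi.
apply: gal_ext; rewrite !galM ?memvf //.
- by rewrite si Zi si.
- by rewrite ZA sA !gal_mul sn Zn ZA sA mulrCA.
- by rewrite ZB sB !gal_mul sn Zn ZB sB mulrCA.
Qed.

End BiquarticGalois.

(** * Norms, finiteness and contraction of ideals *)

Section IdealNorm.
Variable A : comNzRingType.
Implicit Types I J : set A.

Lemma coset_eq I x z : idealr_closed (mem I) ->
  [set y | I (y - x)] = [set y | I (y - z)] <-> I (x - z).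
Proof.
move=> /idealrP[I0 _ IM]; split=> [e|Ixz].
  by have : [set y | I (y - x)] x; [rewrite /= subrr|rewrite e].
have IN u v : I u -> I v -> I (u + v).
  by move=> Iu Iv; rewrite -[u]mul1r; exact: IM.
apply/seteqP; split=> y /= Iy.
  by rewrite -(subrK x y) -addrA; exact: IN.
rewrite -(subrK z y) -addrA; apply: IN => //.
by rewrite -opprB -mulN1r -[_ * _]addr0; exact: IM.
Qed.

Lemma ideal_norm_card I (T : finType) (f : T -> A) : idealr_closed (mem I) ->
  (forall t u, I (f t - f u) -> t = u) -> (forall z, exists t, I (z - f t)) ->
  ideal_norm I = #|T|.
Proof.
move=> idI finj fsurj; rewrite /ideal_norm.
have -> : [set [set y | I (y - x)] | x in [set: A]] =
    [set` ([fset [set y | I (y - f t)] | t in T])%fset].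
  apply/seteqP; split=> C /=.
    move=> [z _ <-]; have [t zt] := fsurj z; apply/imfsetP; exists t => //=.
    exact/coset_eq.
  by move=> /imfsetP[t _ ->]; exists (f t).
rewrite set_fsetK card_imfset /=; first by rewrite -cardE.
by move=> t u /coset_eq => /(_ idI); exact: finj.
Qed.

Lemma ideal_norm_ge I p : idealr_closed (mem I) ->
  finite_set [set [set y | I (y - x)] | x in [set: A]] ->
  (forall m n, (m < p)%N -> (n < p)%N -> I (m%:R - n%:R) -> m = n) ->
  (p <= ideal_norm I)%N.
Proof.
move=> idI fin pI; rewrite /ideal_norm.
pose f (t : 'I_p) := [set y | I (y - (t : nat)%:R)].
have finj : injective f.
  by move=> t u /coset_eq => /(_ idI) /pI h; apply: val_inj; apply: h.
have -> : p = #|` ([fset f t | t in 'I_p])%fset|.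
  by rewrite card_imfset //= -cardE card_ord.
apply: fsubset_leq_card; apply/fsubsetP => C /imfsetP[t _ ->].
by rewrite in_fset_set // inE; exists ((t : nat)%:R).
Qed.

Lemma finite_factor (X Y : Type) (F : finType) (r : X -> F) (g : X -> Y) :
  (forall x y, r x = r y -> g x = g y) -> finite_set (range g).
Proof.
move=> rg; have [[x0 _]|nX] := pselect (exists x : X, True); last first.
  rewrite (_ : range g = set0); first exact: finite_set0.
  by rewrite -subset0 => y [x]; case: nX; exists x.
pose h (t : F) : Y := if pselect (exists x, r x = t) is left e
  then g (projT1 (cid e)) else g x0.
apply: (@sub_finite_set _ _ (h @` setT)); last exact/finite_image/finite_finset.
move=> y [x _ <-]; exists (r x) => //; rewrite /h.
case: pselect => [e|[]]; last by exists x.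
by apply: rg; exact: projT2 (cid e).
Qed.

Section FiniteQuotient.
Variables (m : A) (F : finType) (r : A -> F).
Hypothesis rm : forall x y, r x = r y -> exists w, x - y = m * w.

Lemma finite_cosets I : idealr_closed (mem I) -> I m ->
  finite_set [set [set y | I (y - x)] | x in [set: A]].
Proof.
move=> idI Im; apply: (@finite_factor _ _ F r) => x y /rm[w e].
apply/coset_eq => //; rewrite e mulrC -[_ * _]addr0.
by have /idealrP[I0 _ IM] := idI; exact: IM.
Qed.

(** An ideal containing [m] is the preimage of its image under [r]. *)
Lemma finite_ideals_over : finite_set [set I : set A | idealr_closed (mem I) /\ I m].
Proof.
pose ok I := `[< idealr_closed (mem I) /\ I m >].
pose R I := (ok I, [set t : F | `[< exists2 x, I x & r x = t >]]%SET).
pose g I := if ok I then I else set0.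
apply: (@sub_finite_set _ _ (range g)).
  by move=> I h; exists I => //; rewrite /g /ok asboolT.
apply: (@finite_factor _ _ _ R) => I J [okE /setP e]; rewrite /g -okE.
case: (boolP (ok I)) okE => // /asboolP[idI Im] /esym /asboolP[idJ Jm].
have sub I' J' : idealr_closed (mem I') -> idealr_closed (mem J') -> J' m ->
    ([set t : F | `[< exists2 x, I' x & r x = t >]]%SET =i
      [set t : F | `[< exists2 x, J' x & r x = t >]]%SET) -> I' `<=` J'.
  move=> idI' /idealrP[_ _ JM] Jm' eI x Ix.
  have : r x \in [set t : F | `[< exists2 x, J' x & r x = t >]]%SET.
    by rewrite -eI inE; apply/asboolP; exists x.
  rewrite inE => /asboolP[y Jy /esym/rm[w exy]].
  by rewrite -(subrK y x) exy mulrC; exact: JM.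
by apply/seteqP; split; apply: sub.
Qed.

End FiniteQuotient.
End IdealNorm.

Section Primes.
Variables (L : splittingFieldType rat).
Implicit Types (K E : {subfield L}).

Definition under K (P : set (full_integers L)) : set (integers K) :=
  [set a | P (incl a)].
Arguments under K P _ : clear implicits.

Lemma lies_overP K P (p : set (integers K)) : lies_over P p <-> p = under K P.
Proof.
rewrite /lies_over; split=> [e|->].
  apply/seteqP; split=> a.
    move=> pa; have : [set integer_val b | b in p] (integer_val a) by exists a.
    rewrite e => -[[b Pb eb] _].
    by rewrite /under /= (_ : incl a = b) //; apply: ival_inj.
  move=> Pa; have : ([set integer_val b | b in P] `&` [set` K]) (integer_val a).
    by split; [exists (incl a)|exact: ival_in].
  by rewrite -e => -[b pb /ival_inj <-].
apply/seteqP; split=> x /=.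
  by move=> [a Pa <-]; split; [exists (incl a)|exact: ival_in].
move=> [[b Pb <-] bK]; exists (mkint bK (ival_integral b)) => //.
by rewrite /under /= (_ : incl _ = b) //; apply: ival_inj.
Qed.

Lemma under_ideal K (P : set (full_integers L)) :
  idealr_closed (mem P) -> idealr_closed (mem (under K P)).
Proof.
move=> /idealrP[P0 P1 PM]; apply/idealrP; rewrite /under /=; split.
- by rewrite rmorph0.
- by rewrite rmorph1.
- by move=> a u v Pu Pv; rewrite rmorphD rmorphM; exact: PM.
Qed.

Lemma under_prime_closed K (P : set (full_integers L)) :
  prime_idealr_closed (mem P) -> prime_idealr_closed (mem (under K P)).
Proof.
move=> prP u v; rewrite !inE /under /= rmorphM => h.
by have := prP (incl u) (incl v); rewrite !inE => /(_ h).
Qed.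

Variable (LC : {rmorphism L -> algC}).

Lemma natr_integers_neq0 E n : n != 0%N -> n%:R != 0 :> integers E.
Proof.
move=> n0; apply/eqP => /(congr1 (LC \o (@integer_val _ _))) /=.
rewrite ival_nat rmorph_nat rmorph0 => /eqP; rewrite pnatr_eq0.
exact/negP.
Qed.

Lemma nonzero_ideal E (I : set (integers E)) n : n != 0%N -> I n%:R ->
  I <> [set 0].
Proof.
by move=> n0 In e; move: In; rewrite e => /eqP; apply/negP/natr_integers_neq0.
Qed.

(** The norm of a nonzero element is one of its multiples. *)
Lemma ideal_nat (I : set (full_integers L)) : idealr_closed (mem I) -> I <> [set 0] ->
  exists2 n, n != 0%N & I n%:R.
Proof.
move=> /idealrP[I0 I1 IM] In0.
have [z Iz z0] : exists2 z, I z & z != 0.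
  apply: contrapT => h; apply: In0; apply/seteqP; split=> z /=; last by move=> ->.
  by move=> Iz; apply/eqP/negPn/negP => z0; apply: h; exists z.
pose N : full_integers L :=
  \prod_(s in 'Gal(fullv / (1%AS : {subfield L}))%g) act s z.
have vN : integer_val N = galNorm 1 fullv (integer_val z).
  rewrite /N /galNorm; elim/big_rec2: _ => // s x y _ <-.
  by rewrite ivalM actE.
have gal1 := galois_fullv (1%AS : {subfield L}).
have N1 : integer_val N \in 1%VS.
  by rewrite vN; apply: mem_galNorm => //; exact: memvf.
have [n en] := rational_integer LC N1 (ival_integral N).
have IN : I N.
  rewrite /N (bigD1 1%g) ?group1 //= mulrC.
  have -> : act 1%g z = z by apply: ival_inj; rewrite actE gal_id.
  by rewrite -[_ * z]addr0; exact: IM.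
have eN : N = n%:~R by apply: ival_inj; rewrite ival_int.
have n0 : n != 0.
  apply/eqP => n0; move: en; rewrite n0 vN => /eqP; rewrite galNorm_eq0.
  by move=> /eqP z00; move/eqP: z0; apply; apply: ival_inj.
exists `|n|%N; first by rewrite absz_eq0.
have : I (n%:~R * N + 0) \/ I N by right.
case: n eN {en n0} => n en _; first by move: IN; rewrite en.
have := IM (-1) _ _ IN I0.
by rewrite addr0 mulN1r en NegzE rmorphN opprK.
Qed.

Lemma prime_ideal_nat E (I : set (integers E)) n : idealr_closed (mem I) ->
  prime_idealr_closed (mem I) -> n != 0%N -> I n%:R ->
  exists2 p, prime p & (p %| n)%N /\ I p%:R.
Proof.
move=> /idealrP[I0 I1 IM] prI; elim/ltn_ind: n => n IH n0 In.
have [n1|n1] := leqP n 1.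
  by case: n n0 In n1 {IH} => [|[|]].
have := prI (pdiv n)%:R (n %/ pdiv n)%:R.
rewrite -natrM mulnC divnK ?pdiv_dvd // !inE => /(_ In)/orP[] /set_mem Id.
  by exists (pdiv n); [exact: pdiv_prime|split => //; exact: pdiv_dvd].
have [|||p pp [pd Ip]] := IH (n %/ pdiv n)%N => //.
- by rewrite ltn_Pdiv ?pdiv_prime ?prime_gt1 ?pdiv_prime // lt0n.
- rewrite -lt0n divn_gt0 ?pdiv_gt0 // pdiv_leq // lt0n //.
- exists p => //; split => //; apply: dvdn_trans pd _.
  by apply: dvdn_div; exact: pdiv_dvd.
Qed.

Lemma ideal_coprime E (I : set (integers E)) m n : idealr_closed (mem I) ->
  I m%:R -> I n%:R -> (0 < m)%N -> ~~ coprime m n.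
Proof.
move=> /idealrP[I0 I1 IM] Im In m0; apply/negP => /(coprimeP _ m0)[[u v] /= e].
apply: I1; have -> : 1 = u%:R * m%:R + (- v%:R * n%:R + 0) :> integers E.
  rewrite -[LHS]/(1%:R : integers E) -[in LHS]e natrB; last by lia.
  by rewrite !natrM mulNr addr0.
by apply: (IM) => //; apply: IM.
Qed.

Lemma ideal_prime_dvd E (I : set (integers E)) p n : idealr_closed (mem I) ->
  prime p -> I p%:R -> I n%:R -> (p %| n)%N.
Proof.
move=> idI pp Ip In; apply: contraT => pn.
have := ideal_coprime idI Ip In (prime_gt0 pp).
by rewrite prime_coprime // pn.
Qed.

End Primes.
Arguments under {L} K P _.

(** * Frobenius congruences and unramified primes *)

Section Unramified.
Variables (A : comNzRingType) (P : set A) (p Q : nat).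
Hypotheses (idP : idealr_closed (mem P)) (prP : prime_idealr_closed (mem P)).

(** Since [z ^ Q = z] modulo [p], each [z] is annihilated modulo [p] by
    [1 - z ^ (Q - 1)], which lies outside every prime containing [z].  An
    expression of [p] as an element of [P ^ 2] would then be multiplied into
    [p ^ 2 A] by an element outside [P]. *)
Lemma prime_notin_sqr : (1 < Q)%N -> (forall x : A, p%:R * x = 0 -> x = 0) ->
  (forall z : A, exists w, z ^+ Q - z = p%:R * w) ->
  P p%:R -> ~ ideal_exp P 2 p%:R.
Proof.
move=> Q1 preg pQ Pp; have /idealrP[P0 P1 PM] := idP.
have Pmul a x : P x -> P (a * x) by move=> Px; rewrite -[_ * _]addr0; exact: PM.
have Padd x y : P x -> P y -> P (x + y).
  by move=> Px Py; rewrite -[x]mul1r; exact: PM.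
have prM x y : P (x * y) -> P x \/ P y.
  move=> h; have := prP (u := x) (v := y); rewrite !inE => /(_ h).
  by case/orP=> /set_mem; [left|right].
have PX x n : P (x ^+ n) -> P x.
  elim: n => [|n IH]; first by rewrite expr0.
  by rewrite exprS => /prM[].
case=> n [a [b [ab e]]].
have Pb j : P (b j).
  have [_ [m [c [d [cd ->]]]]] := ab j.
  elim/big_rec: _ => // l x _ Px; apply: Padd => //; rewrite mulrC.
  by apply: Pmul; case: (cd l).
have Pa j : P (a j) by case: (ab j).
pose u (x : A) := 1 - x ^+ Q.-1.
have Qe : Q = Q.-1.+1 by rewrite prednK // (ltn_trans _ Q1).
have uP x : P x -> ~ P (u x).
  move=> Px Pu; apply: P1; rewrite -(subrK (x ^+ Q.-1) 1); apply: Padd => //.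
  have -> : Q.-1 = Q.-2.+1 by rewrite prednK //; case: (Q) Q1 => [|[]].
  by rewrite exprSr; exact: Pmul.
have uw x : exists w, u x * x = p%:R * w.
  have [w ew] := pQ x; exists (- w); rewrite mulrN -ew opprB /u mulrBl mul1r.
  by rewrite -exprSr -Qe.
pose t := \prod_(j < n) (u (a j) * u (b j)).
have tP : ~ P t.
  rewrite /t; elim/big_rec: _ => // j x _ nx /prM[/prM[]|] //.
    by apply: uP.
  by apply: uP.
have tw (c : 'I_n -> A) j :
    (c = a \/ c = b) -> exists w, t * c j = p%:R * w.
  move=> cab; have [w ew] := uw (c j).
  rewrite /t (bigD1 j) //=; set y := \prod_(_ < _ | _) _.
  case: cab => ec; move: ew; rewrite ec => ew.
    exists (y * u (b j) * w).
    transitivity (y * u (b j) * (u (a j) * a j)); first by ring.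
    by rewrite ew; ring.
  exists (y * u (a j) * w).
  transitivity (y * u (a j) * (u (b j) * b j)); first by ring.
  by rewrite ew; ring.
apply: tP; apply: (PX _ 2).
have [wa ewa] := choice (fun j => tw a j (or_introl erefl)).
have [wb ewb] := choice (fun j => tw b j (or_intror erefl)).
have -> : t ^+ 2 = p%:R * \sum_j wa j * wb j.
  apply/eqP; rewrite -subr_eq0; apply/eqP; apply: preg.
  rewrite mulrBr; apply/eqP; rewrite subr_eq0; apply/eqP.
  rewrite [in LHS]e mulr_suml !mulr_sumr; apply: eq_bigr => j _.
  transitivity ((t * a j) * (t * b j)); first by ring.
  by rewrite ewa ewb; ring.
by rewrite mulrC; exact: Pmul.
Qed.

End Unramified.

Section Residue.
Variables (q : nat) (S : biquartic q).
Notation L := (bq_field S).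
Notation i := (bq_i S).
Notation A := (bq_A S).
Notation B := (bq_B S).
Notation K := (bq_base S).
Notation G := (gal_of (fullv : {subfield L})).
Notation OL := (full_integers L).
Notation iO := (iO S).
Notation AO := (AO S).
Notation BO := (BO S).

Definition iK : integers K := mkint (i_inK S) (i_integral S).
Definition bK : integers K := mkint (B2_inK S) (ival_integral (BO ^+ 2)).

Lemma incl_iK : incl iK = iO. Proof. exact: ival_inj. Qed.
Lemma incl_bK : incl bK = BO ^+ 2. Proof. exact: ival_inj. Qed.

Section Char.
Variables (k : comNzRingType) (p : nat) (f : {rmorphism OL -> k}).
Hypotheses (chp : p \in [pchar k]) (p2q : coprime (2 * q) p).

Lemma bdenom_unit n : exists c : k, c * ((4 * q ^ 2) ^ n)%:R = 1.
Proof.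
apply: (natr_unit chp); apply: coprimeXl.
move: p2q; rewrite coprimeMl => /andP[c2 cq].
by rewrite (_ : 4 = 2 ^ 2)%N // coprimeMl !coprimeXl.
Qed.

Lemma residue_i2 : f iO ^+ 2 = -1.
Proof. by rewrite -rmorphXn iO2 rmorphN rmorph1. Qed.
Lemma residue_A4 : f AO ^+ 4 = q%:R * (1 + f iO).
Proof. by rewrite -rmorphXn AO4 rmorphM rmorph_nat rmorphD rmorph1. Qed.
Lemma residue_B4 : f BO ^+ 4 = q%:R * (1 - f iO).
Proof. by rewrite -rmorphXn BO4 rmorphM rmorph_nat rmorphB rmorph1. Qed.

(** Both sides are ring morphisms in [z], since the characteristic is [p], so
    they agree on the ring generated by [i], [A] and [B]; the remaining
    denominators are invertible. *)
Lemma frobenius_generators (s : G) n :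
  f (act s iO) = f iO ^+ (p ^ n) -> f (act s AO) = f AO ^+ (p ^ n) ->
  f (act s BO) = f BO ^+ (p ^ n) -> forall z, f (act s z) = f z ^+ (p ^ n).
Proof.
move=> si sA sB z; pose T := [set z : OL | f (act s z) = f z ^+ (p ^ n)].
have sT : subring_set T.
  split=> [|x y|x y]; rewrite /T /=; first by rewrite !rmorph1 expr1n.
    by move=> ex ey; rewrite !rmorphB ex ey (frobD chp) (frobN chp).
  by move=> ex ey; rewrite !rmorphM ex ey exprMn.
have [c] := bdenom_unit 5; have := covers_full sT si sA sB z.
rewrite /T /= -/(bdenom q); move: (bdenom q) => d e ec.
rewrite !rmorphM !rmorph_nat exprMn (frob_nat chp) in e.
by rewrite -[LHS]mul1r -[RHS]mul1r -ec -!mulrA e.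
Qed.

End Char.

Lemma ideal_of_prime p : prime p ->
  idealr_closed (mem [set x : OL | exists w, x = p%:R * w]).
Proof.
move=> pp; apply/idealrP; split.
- by exists 0; rewrite mulr0.
- move=> [w e].
  have ew : (1 : L) = p%:R * integer_val w.
    by have := congr1 (@integer_val _ _) e; rewrite !ivalE.
  have p0 : (p%:R : L) != 0 by rewrite natr_bq_eq0 -lt0n prime_gt0.
  have wr : integer_val w = (p%:R^-1 : rat)%:A.
    apply: (mulfI p0); rewrite -ew mulr_algr -scaler_nat.
    by rewrite scalerA mulVf ?scale1r // pnatr_eq0 -lt0n prime_gt0.
  have w1 : integer_val w \in 1%VS by rewrite wr rpredZ // mem1v.
  have [n en] := rational_integer (bq_C S) w1 (ival_integral w).
  have : bq_C S (p%:R * n%:~R) = 1 by rewrite -en -ew rmorph1.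
  rewrite rmorphM rmorph_nat rmorph_int -[p%:R]/(p%:~R) -intrM => /eqP.
  rewrite -[1]/(1%:~R) eqr_int => /eqP h.
  have := prime_gt1 pp; have : (p %| 1)%N.
    by apply/dvdnP; exists `|n|%N; have := congr1 absz h; rewrite abszM /=; lia.
  by rewrite dvdn1 => /eqP ->.
- by move=> a u v [x ->] [y ->]; exists (a * x + y); ring.
Qed.

(** The generators are fixed by the [p ^ 8]-th power map modulo [p], hence so
    is everything else. *)
Lemma OL_reduced p : prime p -> coprime (2 * q) p ->
  forall z : OL, exists w, z ^+ (p ^ 8) - z = p%:R * w.
Proof.
move=> pp p2q z; have idI := ideal_of_prime pp.
have [k [f [fI _]]] := quotient_ring idI.
have chp : p \in [pchar k].
  by rewrite inE pp /= -(rmorph_nat f); apply/eqP/fI; exists 1; rewrite mulr1.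
have fi := residue_i2 f.
have act1 (x : OL) : act 1%g x = x by apply: ival_inj; rewrite actE gal_id.
have fim : (- f iO) ^+ 2 = -1 by rewrite sqrrN.
have := @frobenius_generators k p f chp p2q 1%g 8; rewrite !act1.
rewrite (fourth_root_frob8 chp fi (residue_A4 f)) //.
rewrite (fourth_root_frob8 chp fim (residue_B4 f)) //.
have po : odd p.
  by case: (even_prime pp) => // p2; move: p2q; rewrite p2 coprimeMl.
have -> : f iO ^+ (p ^ 8) = f iO.
  rewrite (@expr_imag_mod4 _ _ (p ^ 8) 1 fi) // -modnXm.
  have : (p %% 4 < 4)%N by rewrite ltn_mod.
  have : odd (p %% 4)%N by rewrite odd_mod.
  by case: (p %% 4)%N => [|[|[|[|]]]].
move=> h; have := h erefl erefl erefl z; rewrite act1 -rmorphXn => e.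
by apply/fI; rewrite rmorphB [X in _ - X]e subrr.
Qed.

Lemma bq_unramified p (pK : set (integers K)) : prime p -> coprime (2 * q) p ->
  idealr_closed (mem pK) -> pK p%:R -> unramified (fullv : {subfield L}) pK.
Proof.
move=> pp p2q idp Ip P [idP prP Pn0] /lies_overP eP; split.
  move=> x [n [a [b [ab e]]]]; exists n, (fun j => incl (a j)), b; split.
    by move=> j; split=> //; have := ab j; rewrite eP.
  apply: ival_inj; rewrite e.
  have -> : integer_val (\sum_j incl (a j) * b j) =
      \sum_j integer_val (incl (a j) * b j).
    by elim/big_rec2: _ => // j x' y' _ <-; rewrite ivalD.
  by apply: eq_bigr => j _; rewrite ivalM.
move=> sub; have Pp : P p%:R by move: Ip; rewrite eP /under /= rmorph_nat.
apply: (@prime_notin_sqr _ P p (p ^ 8) idP prP) => //.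
- by rewrite -{1}(exp1n 8) ltn_exp2r // prime_gt1.
- move=> x e; apply: ival_inj; apply/eqP.
  have := congr1 (@integer_val _ _) e; rewrite !ivalE => /eqP.
  rewrite mulf_eq0 natr_bq_eq0 => /orP[|//] /eqP p0.
  by move: pp; rewrite p0.
- exact: OL_reduced.
apply: sub; exists 1%N, (fun _ => p%:R), (fun _ => 1); split=> //.
by rewrite big_ord1 !ivalE mulr1.
Qed.

End Residue.

(** * Residue fields of the primes of [K] *)

Section Residues.
Variables (q : nat) (S : biquartic q).
Notation L := (bq_field S).
Notation i := (bq_i S).
Notation A := (bq_A S).
Notation B := (bq_B S).
Notation K := (bq_base S).
Notation G := (gal_of (fullv : {subfield L})).
Notation OL := (full_integers L).
Notation iO := (iO S).
Notation AO := (AO S).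
Notation BO := (BO S).
Notation X := (bq_X S).
Notation Y := (bq_Y S).

Section Residue.
Variables (P : set OL) (k : idomainType) (p : nat) (f : {rmorphism OL -> k}).
Hypotheses (fP : forall x, f x = 0 <-> P x).
Hypotheses (idP : idealr_closed (mem P)).
Hypotheses (chp : p \in [pchar k]) (p2q : coprime (2 * q) p).
Let pp := pcharf_prime chp.
Let i2f := residue_i2 f.
Let A4f := residue_A4 f.
Let B4f := residue_B4 f.
Let Ni2f : (- f iO) ^+ 2 = -1. Proof. by rewrite sqrrN. Qed.

Lemma frobenius_atP (s : G) : frobenius_at P (under K P) s <->
  s \in 'Gal(fullv / K)%g /\
  forall z, f (act s z) = f z ^+ ideal_norm (under K P).
Proof.
have e z : [set integer_val b | b in P]
      (s (integer_val z) - integer_val z ^+ ideal_norm (under K P)) <->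
    f (act s z) = f z ^+ ideal_norm (under K P).
  set N := ideal_norm _.
  split=> [[b Pb eb]|h].
    have eb' : b = act s z - z ^+ N by apply: ival_inj; rewrite eb !ivalE actE.
    have /eqP := (fP _).2 Pb; rewrite eb' rmorphB rmorphXn subr_eq0.
    by move/eqP.
  exists (act s z - z ^+ N); last by rewrite !ivalE actE.
  by apply/fP; rewrite rmorphB rmorphXn h subrr.
by split=> -[sK h]; split=> // z; apply/e.
Qed.

Lemma residue_B_neq0 : f BO != 0.
Proof. exact: quartic_root_neq0 chp p2q _ _ Ni2f B4f. Qed.

Lemma residue_A_neq0 : f AO != 0.
Proof. exact: quartic_root_neq0 chp p2q _ _ i2f A4f. Qed.

(** Away from [2 q] the residue field of [K] is generated over the prime field
    by [i] and [B ^ 2]. *)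
Lemma ideal_norm_split : (p %% 4 = 1)%N -> (f BO ^+ 2) ^+ p = f BO ^+ 2 ->
  (forall z, integer_val z \in K -> f z ^+ p = f z) /\
  ideal_norm (under K P) = p.
Proof.
move=> p1 bp; have frobp z : integer_val z \in K -> f z ^+ p = f z.
  pose T := [set z : OL | f z ^+ p = f z].
  have N1 (x : k) : (- x) ^+ p = - x ^+ p by rewrite -[p]expn1 (frobN chp).
  have D1 (x y : k) : (x + y) ^+ p = x ^+ p + y ^+ p.
    by rewrite -[p]expn1 (frobD chp).
  have sT : subring_set T.
    split=> [|x y|x y]; rewrite /T /=; first by rewrite rmorph1 expr1n.
      by move=> ex ey; rewrite rmorphB D1 N1 ex ey.
    by move=> ex ey; rewrite rmorphM exprMn ex ey.
  have Ti : T iO by rewrite /T /=; exact: frob_i i2f p1.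
  have TB : T (BO ^+ 2) by rewrite /T /= rmorphXn.
  move=> zK; have := covers_base sT Ti TB zK; rewrite /T /=.
  have [c] := bdenom_unit chp p2q 2; move: (_ ^ 2)%N => d ec.
  rewrite rmorphM rmorph_nat exprMn -[p in X in X * _ = _]expn1 (frob_nat chp).
  by move=> e; rewrite -[LHS]mul1r -[RHS]mul1r -ec -!mulrA e.
split=> //.
pose t (u : 'I_p) : integers K := (u : nat)%:R.
rewrite (@ideal_norm_card _ _ _ t) ?card_ord //.
- exact: under_ideal.
- move=> u v; rewrite /under /= => /fP; rewrite !rmorphB !rmorph_nat => /eqP.
  rewrite subr_eq0 => /eqP /(natr_eq_mod chp); rewrite !modn_small // => e.
  exact: val_inj.
move=> z; have [n [np en]] := frob_fixed_nat chp (frobp (incl z) (ival_in z)).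
exists (Ordinal np); rewrite /under /=; apply/fP.
by rewrite !rmorphB !rmorph_nat en subrr.
Qed.

Lemma ideal_norm_inert : (p %% 4 = 1)%N -> (f BO ^+ 2) ^+ p = - f BO ^+ 2 ->
  ideal_norm (under K P) = (p ^ 2)%N.
Proof.
move=> p1 bp; have N1 (x : k) : (- x) ^+ p = - x ^+ p.
  by rewrite -[p]expn1 (frobN chp).
have D1 (x y : k) : (x + y) ^+ p = x ^+ p + y ^+ p.
  by rewrite -[p]expn1 (frobD chp).
have nat1 n : (n%:R : k) ^+ p = n%:R by rewrite -[p]expn1 (frob_nat chp).
set b := f BO ^+ 2 in bp *.
have [b2 eb2 b2p] : exists2 c, c = b ^+ 2 & c ^+ p = c.
  exists (b ^+ 2) => //; by rewrite -exprM mulnC exprM bp sqrrN.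
have dec z : integer_val z \in K ->
    exists x y : k, [/\ x ^+ p = x, y ^+ p = y & f z = x + y * b].
  pose T := [set z : OL |
    exists x y : k, [/\ x ^+ p = x, y ^+ p = y & f z = x + y * b]].
  have p0 : (0 ^+ p = 0 :> k) by rewrite expr0n eqn0Ngt prime_gt0.
  have sT : subring_set T.
    split=> [|u v|u v]; rewrite /T /=.
    - by exists 1, 0; rewrite rmorph1 expr1n p0 mul0r addr0.
    - move=> [x [y [xp yp eu]]] [x' [y' [xp' yp' ev]]]; exists (x - x'), (y - y').
      rewrite rmorphB eu ev !D1 !N1 xp yp xp' yp'; split=> //; ring.
    - move=> [x [y [xp yp eu]]] [x' [y' [xp' yp' ev]]].
      exists (x * x' + y * y' * b2), (x * y' + x' * y).
      rewrite rmorphM eu ev !D1 !exprMn xp yp xp' yp' b2p; split=> //.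
      by rewrite eb2; ring.
  have Ti : T iO.
    by exists (f iO), 0; rewrite (frob_i i2f p1) p0 mul0r addr0.
  have TB : T (BO ^+ 2).
    by exists 0, 1; rewrite expr1n p0 mul1r add0r rmorphXn.
  move=> zK; have := covers_base sT Ti TB zK; rewrite /T /=.
  have [c] := bdenom_unit chp p2q 2; move: (_ ^ 2)%N => d ec [x [y [xp yp e]]].
  rewrite rmorphM rmorph_nat in e.
  have cp : c ^+ p = c.
    have := congr1 (fun x => x ^+ p) ec; rewrite /= exprMn nat1 expr1n.
    by move=> h; rewrite -[LHS]mulr1 -ec mulrCA [_ * d%:R]h mulr1.
  exists (c * x), (c * y); rewrite !exprMn cp xp yp; split=> //.
  by rewrite -[LHS]mul1r -ec -mulrA e mulrDr mulrA.
pose t (u : 'I_p * 'I_p) : integers K := (u.1 : nat)%:R + (u.2 : nat)%:R * bK S.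
have ft u : f (incl (t u)) = (u.1 : nat)%:R + (u.2 : nat)%:R * b.
  have -> : incl (t u) = (u.1 : nat)%:R + (u.2 : nat)%:R * BO ^+ 2.
    by apply: ival_inj; rewrite /t !ivalE.
  by rewrite rmorphD rmorphM !rmorph_nat rmorphXn.
rewrite (@ideal_norm_card _ _ _ t) ?card_prod ?card_ord ?mulnn //.
- exact: under_ideal.
- move=> u v; rewrite /under /= => /fP; rewrite !rmorphB !ft => /eqP.
  rewrite subr_eq0 => /eqP e.
  set x : k := (u.2 : nat)%:R - (v.2 : nat)%:R.
  have e1 : x * b = (v.1 : nat)%:R - (u.1 : nat)%:R.
    transitivity ((u.1 : nat)%:R + (u.2 : nat)%:R * b - (u.1 : nat)%:R
      - (v.2 : nat)%:R * b); first by rewrite /x; ring.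
    by rewrite e; ring.
  have xp : x ^+ p = x by rewrite /x D1 N1 !nat1.
  (* The Frobenius map fixes [x] and negates [b], so [x b] is its own opposite. *)
  have : (x * b) ^+ p = x * b by rewrite e1 D1 N1 !nat1.
  rewrite exprMn xp bp mulrN => /esym /(eqr_opp0 chp p2q)/eqP.
  rewrite mulf_eq0 expf_eq0 (negPf residue_B_neq0) andbF orbF subr_eq0.
  move=> /eqP x0; have eu : (u.1 : nat)%:R = (v.1 : nat)%:R :> k.
    by move: e; rewrite x0 => /addIr.
  move: x0 eu => /(natr_eq_mod chp) h2 /(natr_eq_mod chp) h1.
  move: h1 h2; rewrite !modn_small // => h1 h2.
  by rewrite [u]surjective_pairing [v]surjective_pairing; congr pair; apply: val_inj.
move=> z; have [x [y [xp yp e]]] := dec (incl z) (ival_in z).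
have [n [np en]] := frob_fixed_nat chp xp.
have [m [mp em]] := frob_fixed_nat chp yp.
exists (Ordinal np, Ordinal mp); rewrite /under /=; apply/fP.
by rewrite rmorphB rmorphB ft e en em subrr.
Qed.

Lemma sqr_frob_B : (p %% 4 = 1)%N ->
  (f BO ^+ 2) ^+ p = f BO ^+ 2 \/ (f BO ^+ 2) ^+ p = - f BO ^+ 2.
Proof. by move=> p1; exact: (sqr_frob chp p1 Ni2f B4f). Qed.

(** A prime inert in the Gaussian field is excluded by [quartic_root_inert]; over
    the other primes of degree two [B ^ (p ^ 2) = - B], whereas [X] fixes [B]. *)
Lemma frobenius_X_split : frobenius_at P (under K P) X ->
  (p %% 4 = 1)%N /\ (f BO ^+ 2) ^+ p = f BO ^+ 2.
Proof.
move=> /frobenius_atP[_]; set N := ideal_norm _ => h.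
have [Xi XA XB] := bq_XP S.
have iN : f iO ^+ N = f iO.
  by rewrite -h; congr (f _); apply: ival_inj; rewrite actE.
have aN : f AO ^+ N = - f AO.
  by rewrite -h -rmorphN; congr (f _); apply: ival_inj; rewrite actE ivalN.
have bN : f BO ^+ N = f BO.
  by rewrite -h; congr (f _); apply: ival_inj; rewrite actE.
have po : odd p := residue_char_odd chp p2q.
have p4 : (p %% 4 = 1 \/ p %% 4 = 3)%N.
  have : (p %% 4 < 4)%N by rewrite ltn_mod.
  have : odd (p %% 4)%N by rewrite odd_mod.
  by case: (p %% 4)%N => [|[|[|[|]]]] // _ _; [left|right].
case: p4 => p4; last by case: (quartic_root_inert chp p2q i2f p4 A4f B4f iN bN aN).
split=> //; case: (sqr_frob_B p4) => // bp.
move: bN; rewrite /N (ideal_norm_inert p4 bp).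
rewrite (frob2_nonsquare chp i2f p4 bp) => /esym /(eqr_opp0 chp p2q) /eqP.
by rewrite (negPf residue_B_neq0).
Qed.

(** The four powers of [i] keep distinct residues because 2 is invertible. *)
Lemma expf_i_inj m n : f iO ^+ m = f iO ^+ n -> i ^+ m = i ^+ n.
Proof.
have t0 := residue_two_neq0 chp p2q.
rewrite (expr_imag_mod4 (i := f iO) i2f (erefl (m %% 4)%N)).
rewrite (expr_imag_mod4 (i := f iO) i2f (erefl (n %% 4)%N)).
rewrite (expr_imag_mod4 (i := i) (bq_i2 S) (erefl (m %% 4)%N)).
rewrite (expr_imag_mod4 (i := i) (bq_i2 S) (erefl (n %% 4)%N)).
have n1 : (1 != -1 :> k) by rewrite -addr_eq0.
have n2 (e : k) : e ^+ 2 = -1 -> (e != 1) * (e != -1).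
  move=> e2; split; apply/eqP => e1; move: e2;
    by rewrite e1 ?sqrrN expr1n => /eqP; rewrite (negPf n1).
have ni : f iO != - f iO.
  apply/eqP => /(eqr_opp0 chp p2q) i0; move: i2f; rewrite i0 expr0n /= => /esym/eqP.
  by rewrite oppr_eq0 oner_eq0.
have [h1 h2] := n2 _ i2f; have [h3 h4] := n2 _ Ni2f.
have : (m %% 4 < 4)%N by rewrite ltn_mod. have : (n %% 4 < 4)%N by rewrite ltn_mod.
have e3 : f iO ^+ 3 = - f iO by rewrite exprS i2f mulrN1.
by case: (m %% 4)%N => [|[|[|[|]]]] //; case: (n %% 4)%N => [|[|[|[|]]]] // _ _;
  rewrite ?e3 ?i2f ?expr0 ?expr1 => /eqP; rewrite 1?eq_sym;
  rewrite ?(negPf n1) ?(negPf h1) ?(negPf h2) ?(negPf h3) ?(negPf h4) ?(negPf ni) //;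
  rewrite eq_sym ?(negPf n1) ?(negPf h1) ?(negPf h2) ?(negPf h3);
  rewrite ?(negPf h4) ?(negPf ni).
Qed.

End Residue.
End Residues.

(** * Frobenius elements *)

Section Frobenius.
Variables (q : nat) (S : biquartic q).
Notation L := (bq_field S).
Notation i := (bq_i S).
Notation A := (bq_A S).
Notation B := (bq_B S).
Notation K := (bq_base S).
Notation G := (gal_of (fullv : {subfield L})).
Notation OL := (full_integers L).
Notation iO := (iO S).
Notation AO := (AO S).
Notation BO := (BO S).
Notation X := (bq_X S).
Notation Y := (bq_Y S).

Lemma residue_char (P : set OL) (k : idomainType) (f : {rmorphism OL -> k}) p :
  (forall x, f x = 0 <-> P x) -> prime p -> P p%:R -> p \in [pchar k].
Proof.
by move=> fP pp Pp; rewrite inE pp /= -(rmorph_nat f); apply/eqP/fP.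
Qed.

Lemma incl_kummer (h : integers K) n m :
  incl (iK S ^+ n - h ^+ m) = iO ^+ n - incl h ^+ m.
Proof. by apply: ival_inj; rewrite !ivalE. Qed.

Lemma act_root_kummer (P : set OL) (k : idomainType) (f : {rmorphism OL -> k})
    (g : OL) (h : integers K) (s : G) n N :
  (forall x, f x = 0 <-> P x) -> f g != 0 -> g ^+ 4 = incl h ->
  act s g = iO ^+ n * g -> (N %% 4 = 1)%N -> f (act s g) = f g ^+ N ->
  under K P (iK S ^+ n - h ^+ (N %/ 4)).
Proof.
move=> fP g0 gh sg N1; rewrite sg rmorphM {1}(divn_eq N 4) N1 exprD mulnC exprM.
rewrite -!rmorphXn => /(mulIf g0) e; apply/fP; rewrite incl_kummer -gh.
by rewrite rmorphB e subrr.
Qed.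

(** Frobenius elements multiply [A] and [B] by fourth roots of unity whose
    residues are powers of the residues of [A ^ 4] and [B ^ 4], which depend
    on the prime of [K] only. *)
Lemma frobenius_unique (P1 P2 : set OL) p (s1 s2 : G) :
  prime_ideal P1 -> prime_ideal P2 -> under K P1 = under K P2 ->
  prime p -> coprime (2 * q) p -> P1 p%:R ->
  (ideal_norm (under K P1) %% 4 = 1)%N ->
  frobenius_at P1 (under K P1) s1 -> frobenius_at P2 (under K P2) s2 ->
  s1 = s2.
Proof.
move=> [id1 pr1 _] [id2 pr2 _] eu pp p2q P1p N1.
have P2p : P2 p%:R.
  have : under K P1 p%:R by rewrite /under /= rmorph_nat.
  by rewrite eu /under /= rmorph_nat.
have [k1 [f1 f1P]] := residue_domain id1 pr1.
have [k2 [f2 f2P]] := residue_domain id2 pr2.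
have ch1 := residue_char f1P pp P1p; have ch2 := residue_char f2P pp P2p.
move=> /(frobenius_atP f1P)[s1K F1] /(frobenius_atP f2P)[s2K F2].
rewrite -eu in F2; set N := ideal_norm _ in N1 F1 F2.
have [si1 [a1 sA1] [b1 sB1]] := galK_root s1K.
have [si2 [a2 sA2] [b2 sB2]] := galK_root s2K.
have key (g : OL) (h : integers K) n1 n2 : f1 g != 0 -> f2 g != 0 ->
    g ^+ 4 = incl h -> act s1 g = iO ^+ n1 * g -> act s2 g = iO ^+ n2 * g ->
    i ^+ n1 = i ^+ n2.
  move=> g1 g2 gh e1 e2.
  have := act_root_kummer f1P g1 gh e1 N1 (F1 g); rewrite eu => /f2P U1.
  have /f2P U2 := act_root_kummer f2P g2 gh e2 N1 (F2 g).
  apply: (expf_i_inj ch2 p2q (f := f2)).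
  move: U1 U2; rewrite !incl_kummer !rmorphB -!rmorphXn => /eqP + /eqP.
  by rewrite !subr_eq0 => /eqP -> /eqP ->.
have mkO (s : G) (g : OL) n : s (integer_val g) = i ^+ n * integer_val g ->
    act s g = iO ^+ n * g.
  by move=> e; apply: ival_inj; rewrite actE e !ivalE.
apply: gal_ext; first by rewrite si1.
  rewrite sA1 sA2; congr (_ * _).
  apply: (key AO (mkint (A4_inK S) (ival_integral (AO ^+ 4)))).
  - exact: (residue_A_neq0 f1 ch1 p2q).
  - exact: (residue_A_neq0 f2 ch2 p2q).
  - exact: ival_inj.
  - exact: mkO.
  - exact: mkO.
rewrite sB1 sB2; congr (_ * _).
apply: (key BO (mkint (B4_inK S) (ival_integral (BO ^+ 4)))).
- exact: (residue_B_neq0 f1 ch1 p2q).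
- exact: (residue_B_neq0 f2 ch2 p2q).
- exact: ival_inj.
- exact: mkO.
- exact: mkO.
Qed.

Lemma prime_ideal_under (P : set OL) n : prime_ideal P -> n != 0%N -> P n%:R ->
  prime_ideal (under K P).
Proof.
move=> [idP prP _] n0 Pn; split.
- exact: under_ideal.
- exact: under_prime_closed.
- by apply: (nonzero_ideal (bq_C S) n0); rewrite /under /= rmorph_nat.
Qed.

(** Uniqueness turns a single Frobenius element into the whole set. *)
Lemma Frob_under (P : set OL) p (s : G) : prime_ideal P ->
  prime p -> coprime (2 * q) p -> P p%:R ->
  (ideal_norm (under K P) %% 4 = 1)%N ->
  frobenius_at P (under K P) s ->
  Frob (fullv : {subfield L}) (under K P) = [set s]%SET.
Proof.
move=> prP pp p2q Pp N1 Fs; apply/setP => t; rewrite !inE.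
apply/asboolP/eqP => [[P' [prP' /lies_overP eu Ft]]|->].
  apply/esym; apply: (frobenius_unique prP prP' eu pp p2q Pp N1 Fs).
  by rewrite -eu.
by exists P; split=> //; exact/lies_overP.
Qed.

(** The preimage under [g] rather than the image, so that a residue map of [P]
    composed with [g] is a residue map of [pull g P]. *)
Definition pull (g : G) (P : set OL) : set OL := [set z | P (act g z)].

Lemma pull_ideal g (P : set OL) :
  idealr_closed (mem P) -> idealr_closed (mem (pull g P)).
Proof.
move=> /idealrP[P0 P1 PM]; apply/idealrP; rewrite /pull /=; split.
- by rewrite rmorph0.
- by rewrite rmorph1.
- by move=> a u v Pu Pv; rewrite rmorphD rmorphM; exact: PM.
Qed.

Lemma pull_prime g (P : set OL) n : n != 0%N -> P n%:R ->
  prime_ideal P -> prime_ideal (pull g P).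
Proof.
move=> n0 Pn [idP prP _]; split.
- exact: pull_ideal.
- move=> u v; rewrite !inE /pull /= rmorphM => h.
  by have := prP (act g u) (act g v); rewrite !inE => /(_ h).
- by apply: (nonzero_ideal (bq_C S) n0); rewrite /pull /= rmorph_nat.
Qed.

Lemma act_swap (g : G) (c : OL) : g (B ^+ 2) = integer_val c ->
  act g (BO ^+ 2) = c.
Proof. by move=> e; apply: ival_inj; rewrite actE ivalX e. Qed.

(** Over a rational prime [p = 5 (mod 8)], either [q (1 - i)] is a non-square
    at a given prime, or it becomes one after exchanging [A ^ 4] and [B ^ 4]. *)
Lemma inert_prime_exists p : prime p -> (p %% 8 = 5)%N -> coprime (2 * q) p ->
  exists pK : set (integers K),
    [/\ prime_ideal pK, unramified (fullv : {subfield L}) pK,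
        ideal_norm pK = (p ^ 2)%N,
        Frob (fullv : {subfield L}) pK = [set Y]%SET & pK p%:R].
Proof.
move=> pp p5 p2q.
have p1 : (p %% 4 = 1)%N.
  by rewrite -(@modn_dvdm 8 p 4) // p5.
have [P0 [idP0 prP0 IP0]] : exists P : set OL, [/\ idealr_closed (mem P),
    prime_idealr_closed (mem P) & [set x : OL | exists w, x = p%:R * w] `<=` P].
  by apply: prime_above; exact: ideal_of_prime.
have P0p : P0 p%:R by apply: IP0; exists 1; rewrite mulr1.
have p0 : p != 0%N by rewrite -lt0n prime_gt0.
have prim0 : prime_ideal P0 by split=> //; exact: (nonzero_ideal (bq_C S) p0).
have [P [prP Pp [k [f [fP fB]]]]] : exists P : set OL, [/\ prime_ideal P, P p%:R &
    exists (k : idomainType) (f : {rmorphism OL -> k}),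
    (forall x, f x = 0 <-> P x) /\ (f BO ^+ 2) ^+ p = - f BO ^+ 2].
  have [k [f fP]] := residue_domain idP0 prP0.
  have chp := residue_char fP pp P0p.
  have [bp|bp] := sqr_frob_B f chp p1; last by exists P0; split=> //; exists k, f.
  have [g gi gB] := swap_sign S false.
  exists (pull g P0); split.
  - exact: pull_prime P0p prim0.
  - by rewrite /pull /= rmorph_nat.
  exists k, [the {rmorphism OL -> k} of f \o act g]; split; first by move=> x; exact: fP.
  have -> : [the {rmorphism OL -> k} of f \o act g] BO ^+ 2 = f AO ^+ 2.
    have e2 : act g (BO ^+ 2) = AO ^+ 2.
      by apply: act_swap; rewrite gB expr0 mul1r ivalX.
    by rewrite -rmorphXn /= e2 rmorphXn.
  have b0 : f BO ^+ 2 != 0 by rewrite expf_neq0 // (residue_B_neq0 f chp p2q).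
  apply: (mulfI b0).
  rewrite (sqr_frob_opp chp p2q (residue_i2 f) p5 (residue_A4 f)
    (residue_B4 f)).
  by rewrite bp mulrN mulrC.
have chp := residue_char fP pp Pp; have [idP primP _] := prP.
have N : ideal_norm (under K P) = (p ^ 2)%N.
  exact: (ideal_norm_inert fP idP chp p2q p1 fB).
have idu := under_ideal K idP.
have up : under K P p%:R by rewrite /under /= rmorph_nat.
exists (under K P); split=> //.
- exact: prime_ideal_under p0 Pp.
- exact: (bq_unramified pp p2q).
apply: (Frob_under prP pp p2q Pp); first by rewrite N -modnXm p1.
apply/(frobenius_atP fP); split; first exact: bq_Y_inG.
have fa : (f AO ^+ 2) ^+ p = f AO ^+ 2.
  have b0 : f BO ^+ 2 != 0 by rewrite expf_neq0 // (residue_B_neq0 f chp p2q).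
  apply: (mulfI b0).
  rewrite (sqr_frob_opp chp p2q (residue_i2 f) p5 (residue_A4 f)
    (residue_B4 f)).
  by rewrite fB mulrN opprK mulrC.
have [Yi YA YB] := bq_YP S.
rewrite N; apply: (frobenius_generators chp p2q).
- have -> : act Y iO = iO by apply: ival_inj; rewrite actE.
  by rewrite [(p ^ 2)%N]expnS expn1 exprM !(frob_i (residue_i2 f) p1).
- have -> : act Y AO = AO by apply: ival_inj; rewrite actE.
  by rewrite (frob2_square chp fa).
- have -> : act Y BO = - BO by apply: ival_inj; rewrite actE ivalN.
  by rewrite (frob2_nonsquare chp (residue_i2 f) p1 fB) rmorphN.
Qed.

End Frobenius.

(** * Matching the primes of degree one *)

Section Matching.
Variables (q : nat) (S : biquartic q).
Notation L := (bq_field S).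
Notation i := (bq_i S).
Notation A := (bq_A S).
Notation B := (bq_B S).
Notation K := (bq_base S).
Notation G := (gal_of (fullv : {subfield L})).
Notation OL := (full_integers L).
Notation OK := (integers K).
Notation iO := (iO S).
Notation AO := (AO S).
Notation BO := (BO S).
Notation X := (bq_X S).
Notation Y := (bq_Y S).
Notation iK := (iK S).
Notation bK := (bK S).

(** A choice depending on [p] and [u] only, which makes the matching below
    injective. *)
Definition sqrt_mod (p u : nat) : nat := xget 0%N [set e | e ^ 2 = u %[mod p]]%N.

Lemma sqrt_modP p u e : (e ^ 2 = u %[mod p])%N -> (sqrt_mod p u ^ 2 = u %[mod p])%N.
Proof. by move=> h; rewrite /sqrt_mod; case: xgetP => [x _ //|/(_ e)]. Qed.

(** An automorphism sending [i] to [- i] sends [B ^ 2] to [A ^ 2] up to sign, and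
    [A ^ 4 = i B ^ 4]; so if [(i, B ^ 2)] has residues [(u, v)] at a prime, it has
    residues [- u] and a square root of [u] times [v] at the conjugate prime. *)
Definition swapped (I J : set OK) := exists p u v : nat,
  [/\ [/\ prime p, coprime (2 * q) p, (u < p)%N & (v < p)%N],
      [/\ I p%:R, I (iK - u%:R) & I (bK - v%:R)],
      [/\ J p%:R, J (iK + u%:R) & J (bK - (sqrt_mod p u)%:R * v%:R)],
      (sqrt_mod p u ^ 2 = u %[mod p])%N & ideal_norm I = p /\ ideal_norm J = p].

Lemma good_residue_prime (P : set OL) : prime_ideal P -> ~ under K P (2 * q)%:R ->
  exists p, [/\ prime p, coprime (2 * q) p & P p%:R].
Proof.
move=> [idP prP Pn0] P2q; have [n n0 Pn] := ideal_nat (bq_C S) idP Pn0.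
have [p pp [_ Pp]] := prime_ideal_nat idP prP n0 Pn; exists p; split=> //.
rewrite coprime_sym prime_coprime //; apply/negP => /dvdnP[m e]; apply: P2q.
rewrite /under /= rmorph_nat e natrM -[_ * _]addr0.
by have /idealrP[P0 _ PM] := idP; exact: PM.
Qed.

(** Conjugation by an automorphism negating [i] turns the Frobenius element
    [X] into [Y]; its sign on [B ^ 2] is chosen to meet the prescribed square
    root of [u]. *)
Lemma swapped_exists (I : set OK) : prime_ideal I -> ~ I (2 * q)%:R ->
  Frob (fullv : {subfield L}) I = [set X]%SET ->
  exists J, [/\ swapped I J, prime_ideal J, unramified (fullv : {subfield L}) J
              & Frob (fullv : {subfield L}) J = [set Y]%SET].
Proof.
move=> prI I2q FI; have : X \in Frob (fullv : {subfield L}) I by rewrite FI set11.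
rewrite inE => /asboolP[P [prP /lies_overP eI FX]].
rewrite eI in prI I2q FX *.
have [p [pp p2q Pp]] := good_residue_prime prP I2q.
have [idP primP Pn0] := prP; have [k [f fP]] := residue_domain idP primP.
have chp := residue_char fP pp Pp.
have [p1 bp] := frobenius_X_split fP idP chp p2q FX.
have [frobK N] := ideal_norm_split fP idP chp p2q p1 bp.
have [u [up eu]] := frob_fixed_nat chp (frob_i (residue_i2 f) p1).
have [v [vp ev]] := frob_fixed_nat chp bp.
have [_ FXz] := (frobenius_atP fP X).1 FX; rewrite N in FXz.
have [Xi XA XB] := bq_XP S.
have ap : (f AO ^+ 2) ^+ p = f AO ^+ 2.
  have := FXz AO; have -> : act X AO = - AO.
    by apply: ival_inj; rewrite actE ivalN.
  by rewrite rmorphN => e; rewrite -exprM mulnC exprM -e sqrrN.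
have [w [wp ew]] := frob_fixed_nat chp ap.
have wuv : (w%:R : k) ^+ 2 = u%:R * v%:R ^+ 2.
  rewrite -ew -ev -eu -!exprM residue_A4 residue_B4 mulrCA mulrBr -expr2.
  rewrite residue_i2 opprK mulr1.
  by rewrite [f iO + 1]addrC.
have v0 : coprime v p.
  rewrite coprime_sym prime_coprime // (dvdn_pcharf chp) -ev expf_neq0 //.
  exact: residue_B_neq0 chp p2q.
have [c cv] := natr_unit chp v0.
(* [w] is the residue of [A ^ 2], so [w / v] is a square root of [u]. *)
have rt : (sqrt_mod p u ^ 2 = u %[mod p])%N.
  have cp : c ^+ p = c.
    have := congr1 (fun x => x ^+ p) cv.
    rewrite /= exprMn -[p in X in _ * X]expn1 (frob_nat chp) expr1n => h.
    by rewrite -[LHS]mulr1 -cv mulrCA [_ * v%:R]h mulr1.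
  have [d [_ ed]] := frob_fixed_nat chp cp.
  apply: (@sqrt_modP p u (w * d)); apply: (natr_eq_mod chp).
  by rewrite natrX natrM exprMn wuv -ed mulrAC -mulrA -exprMn cv expr1n mulr1.
set r := sqrt_mod p u in rt *.
have rv : (w%:R = r%:R * v%:R :> k) \/ (w%:R = - (r%:R * v%:R) :> k).
  apply: sqr_eq_cases; rewrite wuv exprMn; congr (_ * _).
  by rewrite -(GRing.natr_mod_pchar chp) -rt (GRing.natr_mod_pchar chp) natrX.
have [g gi gB] : exists2 g : G, g i = - i & f (act g (BO ^+ 2)) = r%:R * v%:R.
  case: rv => rv; [have [g gi gB] := swap_sign S false
                  |have [g gi gB] := swap_sign S true]; exists g => //.
    have -> : act g (BO ^+ 2) = AO ^+ 2.
      by apply: act_swap; rewrite gB expr0 mul1r ivalX.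
    by rewrite rmorphXn ew.
  have -> : act g (BO ^+ 2) = - AO ^+ 2.
    by apply: act_swap; rewrite gB expr1 mulN1r ivalN ivalX.
  by rewrite rmorphN rmorphXn ew rv opprK.
have p0 : p != 0%N by rewrite -lt0n prime_gt0.
pose P' := pull g P; have prP' : prime_ideal P' by exact: pull_prime Pp prP.
have P'p : P' p%:R by rewrite /P' /pull /= rmorph_nat.
pose f' := [the {rmorphism OL -> k} of f \o act g].
have f'P x : f' x = 0 <-> P' x by exact: fP.
have f'E x : f' x = f (act g x) by [].
have [idP' _ _] := prP'.
have eB : f' BO ^+ 2 = r%:R * v%:R by rewrite -rmorphXn.
have bp' : (f' BO ^+ 2) ^+ p = f' BO ^+ 2.
  by rewrite eB -natrM -[p in LHS]expn1 (frob_nat chp).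
have [_ N'] := ideal_norm_split f'P idP' chp p2q p1 bp'.
have FY : frobenius_at P' (under K P') Y.
  apply/(frobenius_atP f'P); split; first exact: bq_Y_inG.
  move=> z; rewrite N' !f'E -FXz; congr (f _); apply: ival_inj.
  by rewrite !actE; exact: swap_conj.
have up' : under K P' p%:R by rewrite /under /= rmorph_nat.
exists (under K P'); split.
- exists p, u, v; split=> //.
  + split; first by rewrite /under /= rmorph_nat.
      by apply/fP; rewrite rmorphB rmorphB /= incl_iK !rmorph_nat eu subrr.
    by apply/fP; rewrite rmorphB rmorphB /= incl_bK !rmorph_nat rmorphXn ev subrr.
  + split=> //.
      apply/f'P; rewrite rmorphD rmorphD /= incl_iK !rmorph_nat.
      have -> : act g iO = - iO by apply: ival_inj; rewrite actE ivalN.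
      by rewrite rmorphN eu addNr.
    apply/f'P; rewrite -natrM rmorphB rmorphB /= incl_bK !rmorph_nat.
    by rewrite gB natrM subrr.
- exact: prime_ideal_under p0 P'p.
- exact: (bq_unramified pp p2q (under_ideal K idP')).
- by apply: (Frob_under prP' pp p2q P'p) FY; rewrite N'.
Qed.

(** Up to a denominator prime to [p], an integer of [K] is congruent to the
    same rational integer modulo both primes. *)
Lemma split_prime_eq (I J : set OK) p u v : prime_ideal I -> prime_ideal J ->
  prime p -> coprime (2 * q) p -> I p%:R -> J p%:R ->
  I (iK - u%:R) -> J (iK - u%:R) -> I (bK - v%:R) -> J (bK - v%:R) -> I = J.
Proof.
move=> prI prJ pp p2q Ip Jp Ii Ji Ib Jb.
have sub (I' J' : set OK) : prime_ideal I' -> prime_ideal J' ->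
    I' p%:R -> J' p%:R -> I' (iK - u%:R) -> J' (iK - u%:R) ->
    I' (bK - v%:R) -> J' (bK - v%:R) -> I' `<=` J'.
  move=> [idI pI _] [idJ pJ _] {}Ip {}Jp {}Ii {}Ji {}Ib {}Jb z Iz.
  have [kI [f fP]] := residue_domain idI pI.
  have [kJ [h hP]] := residue_domain idJ pJ.
  have chI : p \in [pchar kI].
    by rewrite inE pp /= -(rmorph_nat f); apply/eqP/fP.
  have chJ : p \in [pchar kJ].
    by rewrite inE pp /= -(rmorph_nat h); apply/eqP/hP.
  pose T := [set x : OL | exists2 y : OK, incl y = x &
    exists n : int, f y = n%:~R /\ h y = n%:~R].
  have sT : subring_set T.
    split=> [|x y|x y]; rewrite /T /=.
    - by exists 1; rewrite ?rmorph1 //; exists 1; rewrite !rmorph1.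
    - move=> [x' <- [n [fn hn]]] [y' <- [m [fm hm]]].
      exists (x' - y'); rewrite ?rmorphB //; exists (n - m).
      by rewrite !rmorphB fn hn fm hm.
    - move=> [x' <- [n [fn hn]]] [y' <- [m [fm hm]]].
      exists (x' * y'); rewrite ?rmorphM //; exists (n * m).
      by rewrite !rmorphM fn hn fm hm.
  have Tx (x : OK) c : I' (x - c%:R) -> J' (x - c%:R) -> T (incl x).
    move=> /fP + /hP; rewrite !rmorphB !rmorph_nat => /eqP + /eqP.
    rewrite !subr_eq0 => /eqP fx /eqP hx; exists x => //; exists c%:Z.
    by rewrite fx hx.
  have Ti : T iO by rewrite -incl_iK; exact: Tx Ii Ji.
  have Tb : T (BO ^+ 2) by rewrite -incl_bK; exact: Tx Ib Jb.
  have := @covers_base _ S T sT Ti Tb (incl z) (ival_in z).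
  have [c] := bdenom_unit chJ p2q 2; move: (_ ^ 2)%N => d ec.
  move=> [y ey [n [fn hn]]].
  have ey' : y = d%:R * z by apply: incl_inj; rewrite ey rmorphM rmorph_nat.
  have fz := (fP z).2 Iz.
  have n0 : n%:~R = 0 :> kI by rewrite -fn ey' rmorphM fz mulr0.
  have hn0 : n%:~R = 0 :> kJ.
    have dn m : m%:R = 0 :> kI -> m%:R = 0 :> kJ.
      by move=> /eqP; rewrite -(dvdn_pcharf chI) (dvdn_pcharf chJ) => /eqP.
    case: n n0 {fn hn} => n n0; first exact: dn.
    move: n0; rewrite NegzE !rmorphN => /eqP; rewrite oppr_eq0 => /eqP n0.
    by apply/eqP; rewrite oppr_eq0; apply/eqP; exact: dn.
  apply/hP; rewrite -[LHS]mul1r -ec -mulrA -(rmorph_nat h) -rmorphM -ey' hn hn0.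
  by rewrite mulr0.
by apply/seteqP; split; apply: sub.
Qed.

Lemma swapped_inj (I I' J : set OK) : prime_ideal I -> prime_ideal I' ->
  prime_ideal J -> swapped I J -> swapped I' J -> I = I'.
Proof.
move=> prI prI' [idJ prJ _] [p [u [v [[pp p2q up vp] [Ip Ii Ib] [Jp Ji Jb] rt _]]]].
move=> [p' [u' [v' [[pp' p2q' up' vp'] [Ip' Ii' Ib'] [Jp' Ji' Jb'] rt' _]]]].
have e : p' = p.
  by apply/eqP; rewrite eq_sym -dvdn_prime2 //; exact: ideal_prime_dvd idJ pp Jp Jp'.
rewrite e in pp' p2q' up' vp' Ip' Jp' Jb' rt' *.
have [k [f fP]] := residue_domain idJ prJ.
have chp : p \in [pchar k] by rewrite inE pp /= -(rmorph_nat f); apply/eqP/fP.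
have eu : u = u'.
  move: Ji Ji' => /fP + /fP; rewrite !rmorphD !rmorph_nat => h h'.
  have /(natr_eq_mod chp) : u%:R = u'%:R :> k by apply: (addrI (f iK)); rewrite h h'.
  by rewrite !modn_small.
rewrite -eu in Ii' Jb' rt' *; set r := sqrt_mod p u in rt Jb Jb'.
have residue_i2 : f iK ^+ 2 = -1.
  have -> : f iK ^+ 2 = f (iK ^+ 2) by rewrite rmorphXn.
  have -> : iK ^+ 2 = -1 by apply: ival_inj; rewrite !ivalE; exact: bq_i2.
  by rewrite rmorphN rmorph1.
have r0 : r%:R != 0 :> k.
  apply/eqP => r0; have u0 : u%:R = 0 :> k.
    rewrite -(GRing.natr_mod_pchar chp) -rt (GRing.natr_mod_pchar chp).
    by rewrite natrX r0 expr0n.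
  move: Ji => /fP; rewrite rmorphD rmorph_nat u0 addr0 => i0.
  by move: residue_i2; rewrite i0 expr0n /= => /esym/eqP; rewrite oppr_eq0 oner_eq0.
have ev : v = v'.
  move: Jb Jb' => /fP + /fP; rewrite !rmorphB -!natrM !rmorph_nat => h h'.
  have e2 : r%:R * v%:R = r%:R * v'%:R :> k.
    by apply: oppr_inj; apply: (addrI (f bK)); rewrite -!natrM h h'.
  by have /(natr_eq_mod chp) := mulfI r0 e2; rewrite !modn_small.
rewrite -ev in Ib' *; exact: (split_prime_eq prI prI' pp p2q Ip Ip' Ii Ii' Ib Ib').
Qed.

End Matching.

(** * Comparison of the counting functions *)

Section Counting.
Variables (q : nat) (S : biquartic q).
Notation L := (bq_field S).
Notation K := (bq_base S).
Notation OL := (full_integers L).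
Notation OK := (integers K).
Notation iO := (iO S).
Notation BO := (BO S).
Notation X := (bq_X S).
Notation Y := (bq_Y S).
Notation E := (fullv : {subfield L}).

Definition lattice_point (c0 c1 c2 c3 : int) : OL :=
  c0%:~R + c1%:~R * iO + (c2%:~R + c3%:~R * iO) * BO ^+ 2.

Lemma lattice_subring :
  subring_set [set z | exists c0 c1 c2 c3, z = lattice_point c0 c1 c2 c3].
Proof.
split=> [|x y|x y] /=; rewrite /lattice_point.
- by exists 1, 0, 0, 0; rewrite !mul0r !addr0 mul0r addr0.
- move=> [a0 [a1 [a2 [a3 ->]]]] [b0 [b1 [b2 [b3 ->]]]].
  by exists (a0 - b0), (a1 - b1), (a2 - b2), (a3 - b3); rewrite !rmorphB; ring.
move=> [a0 [a1 [a2 [a3 ->]]]] [b0 [b1 [b2 [b3 ->]]]].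
pose d0 := a2 * b2 - a3 * b3; pose d1 := a2 * b3 + a3 * b2.
exists (a0 * b0 - a1 * b1 + q%:Z * (d0 + d1)),
  (a0 * b1 + a1 * b0 + q%:Z * (d1 - d0)),
  (a0 * b2 - a1 * b3 + a2 * b0 - a3 * b1),
  (a0 * b3 + a1 * b2 + a2 * b1 + a3 * b0).
have eB : (BO ^+ 2) ^+ 2 = q%:R * (1 - iO) by rewrite -exprM BO4.
rewrite /d0 /d1 !(rmorphD, rmorphN, rmorphM) /=.
move: (a0%:~R : OL) (a1%:~R : OL) (a2%:~R : OL) (a3%:~R : OL) => x0 x1 x2 x3.
move: (b0%:~R : OL) (b1%:~R : OL) (b2%:~R : OL) (b3%:~R : OL) => y0 y1 y2 y3.
rewrite -[q%:~R]/(q%:R).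
have i2 := iO2 S; move: (BO ^+ 2) eB => b eb.
transitivity (x0 * y0 + x1 * y1 * iO ^+ 2 + (x0 * y1 + x1 * y0) * iO
  + (x2 * y2 + x3 * y3 * iO ^+ 2 + (x2 * y3 + x3 * y2) * iO) * b ^+ 2
  + ((x0 * y2 + x1 * y3 * iO ^+ 2 + x2 * y0 + x3 * y1 * iO ^+ 2)
  + (x0 * y3 + x1 * y2 + x2 * y1 + x3 * y0) * iO) * b); first by ring.
rewrite eb i2.
transitivity (x0 * y0 - x1 * y1 + (x0 * y1 + x1 * y0) * iO
  + q%:R * ((x2 * y2 - x3 * y3) * (1 - iO)
            + (x2 * y3 + x3 * y2) * (iO - iO ^+ 2))
  + ((x0 * y2 - x1 * y3 + x2 * y0 - x3 * y1)
  + (x0 * y3 + x1 * y2 + x2 * y1 + x3 * y0) * iO) * b); first by ring.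
by rewrite i2; ring.
Qed.

Lemma lattice_coords (x : OK) : exists c : int * int * int * int,
  ((4 * q ^ 2) ^ 2)%:R * incl x = lattice_point c.1.1.1 c.1.1.2 c.1.2 c.2.
Proof.
have Ti : [set z | exists c0 c1 c2 c3, z = lattice_point c0 c1 c2 c3] iO.
  by exists 0, 1, 0, 0; rewrite /lattice_point add0r mul1r mul0r !addr0 mul0r addr0.
have TB : [set z | exists c0 c1 c2 c3, z = lattice_point c0 c1 c2 c3] (BO ^+ 2).
  by exists 0, 0, 1, 0; rewrite /lattice_point !mul0r !addr0 add0r mul1r.
have := @covers_base _ S _ lattice_subring Ti TB (incl x) (ival_in x).
by move=> [c0 [c1 [c2 [c3 e]]]]; exists (c0, c1, c2, c3).
Qed.

(** Coordinates of a fixed multiple [d x] in the lattice spanned by [1], [i],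
    [B ^ 2], [i B ^ 2], taken modulo [d m]. *)
Lemma finite_residues m : m != 0%N -> exists (F : finType) (r : OK -> F),
  forall x y, r x = r y -> exists w, x - y = m%:R * w.
Proof.
move=> m0; pose d := ((4 * q ^ 2) ^ 2)%N; pose N := (d * m)%N.
have d0 : d != 0%N.
  by rewrite /d !(expn_eq0, muln_eq0) /= (negPf (bq_q0 S)).
have N0 : (N > 0)%N by rewrite lt0n muln_eq0 negb_or d0.
pose c x := projT1 (cid (lattice_coords x)).
have cP x : d%:R * incl x = lattice_point (c x).1.1.1 (c x).1.1.2 (c x).1.2 (c x).2.
  exact: projT2 (cid (lattice_coords x)).
have lt_mod (a : int) : (`|(a %% N)%Z| < N)%N.
  have := ltz_pmod a (d := N) N0; have := modz_ge0 a (d := N).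
  by rewrite -lt0n => /(_ N0); lia.
pose h (a : int) : 'I_N := Ordinal (lt_mod a).
have hP a b : h a = h b -> exists t, a - b = N%:Z * t.
  move=> /(congr1 val) /= e.
  have e' : (a %% N)%Z = (b %% N)%Z.
    have := modz_ge0 a (d := N); have := modz_ge0 b (d := N).
    by rewrite -lt0n => /(_ N0) + /(_ N0); lia.
  exists ((a %/ N)%Z - (b %/ N)%Z).
  by rewrite {1}(divz_eq a N) {1}(divz_eq b N) e'; ring.
exists ('I_N * 'I_N * 'I_N * 'I_N)%type.
exists (fun x => (h (c x).1.1.1, h (c x).1.1.2, h (c x).1.2, h (c x).2)).
move=> x y e.
have /hP[t0 e0] := congr1 (fun z => z.1.1.1) e.
have /hP[t1 e1] := congr1 (fun z => z.1.1.2) e.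
have /hP[t2 e2] := congr1 (fun z => z.1.2) e.
have /hP[t3 e3] := congr1 (fun z => z.2) e.
pose w : OK := t0%:~R + t1%:~R * iK S + (t2%:~R + t3%:~R * iK S) * bK S.
have ew : incl w = lattice_point t0 t1 t2 t3.
  by apply: ival_inj; rewrite /w /lattice_point !(ivalE, ival_int).
exists w; apply: incl_inj.
have dz (u v : OL) : d%:R * u = d%:R * v -> u = v.
  move=> /(congr1 (@integer_val _ _)); rewrite !ivalM !ival_nat => /mulfI h'.
  by apply: ival_inj; apply: h'; rewrite natr_bq_eq0.
apply: dz.
have -> : incl (m%:R * w) = m%:R * incl w by rewrite rmorphM rmorph_nat.
have -> : incl (x - y) = incl x - incl y by rewrite rmorphB.
rewrite mulrBr !cP ew /lattice_point.
transitivity (((c x).1.1.1 - (c y).1.1.1)%:~R +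
   ((c x).1.1.2 - (c y).1.1.2)%:~R * iO +
   (((c x).1.2 - (c y).1.2)%:~R + ((c x).2 - (c y).2)%:~R * iO) * BO ^+ 2 : OL).
  by rewrite !rmorphB; ring.
have hN t : (N%:Z * t)%:~R = d%:R * (m%:R * t%:~R) :> OL.
  by rewrite intrM mulrA -natrM.
by rewrite e0 e1 e2 e3 !hN; ring.
Qed.

(** The natural numbers below [p] are incongruent modulo [I]. *)
Lemma prime_le_norm (I : set OK) p : prime_ideal I -> prime p -> I p%:R ->
  (p <= ideal_norm I)%N.
Proof.
move=> [idI prI _] pp Ip; have [F [r rP]] := finite_residues (m := p)
  (ltac:(by rewrite -lt0n prime_gt0)).
apply: ideal_norm_ge => //; first exact: (finite_cosets rP idI Ip).
move=> m n; wlog le_nm : m n / (n <= m)%N.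
  move=> W mp np Imn; case: (leqP n m) => [h|/ltnW h]; first exact: W.
  apply/esym; apply: W => //.
  have /idealrP[I0 _ IM] := idI.
  by rewrite -opprB -mulN1r -[_ * _]addr0; exact: IM.
move=> mp np; rewrite -natrB // => /(ideal_prime_dvd idI pp Ip) pd.
apply/eqP; rewrite eqn_leq le_nm andbT -subn_eq0.
by rewrite -(modn_small (leq_ltn_trans (leq_subr n m) mp)); exact: pd.
Qed.

Variable R : realType.

Definition frob_primes (x : R) (C : {set gal_of E}) := [set I : set OK |
  [/\ prime_ideal I, unramified E I, (ideal_norm I)%:R <= x & Frob E I = C]].

Lemma frob_primes_finite x Z : finite_set (frob_primes x [set Z]%SET).
Proof.
pose m := ((Num.truncn x)`!)%N.
have m0 : m != 0%N by rewrite -lt0n fact_gt0.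
have [F [r rP]] := finite_residues m0.
apply: sub_finite_set (finite_ideals_over rP) => I [prI _ Nx FI].
have [idI priI _] := prI; split=> //.
have : Z \in Frob E I by rewrite FI set11.
rewrite inE => /asboolP[P [[idP prP Pn0] /lies_overP eI _]].
have [n n0 Pn] := ideal_nat (bq_C S) idP Pn0.
have [p pp [_ Pp]] := prime_ideal_nat idP prP n0 Pn.
have Ip : I p%:R by rewrite eI /under /= rmorph_nat.
have pN := prime_le_norm prI pp Ip.
have px : (p <= Num.truncn x)%N.
  apply: leq_trans pN _; rewrite truncn_ge_nat //.
  by apply: le_trans Nx; rewrite ler0n.
have /dvdnP[c ->] : (p %| m)%N by apply: dvdn_fact; rewrite prime_gt0.
rewrite natrM -[_ * _]addr0; have /idealrP[I0 _ IM] := idI; exact: IM.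
Qed.

Lemma frobenius_countE x Z :
  frobenius_count K x [set Z]%SET = #|` fset_set (frob_primes x [set Z]%SET)|%fset.
Proof. by []. Qed.

(** Beyond the finitely many primes over [2 q], the primes with Frobenius
    element [X] inject into those with Frobenius element [Y], and the primes
    of degree two over [p = 5 (mod 8)] are missed. *)
Lemma frobenius_count_lt (ps : seq nat) (x : R) : uniq ps ->
  (forall p, p \in ps -> [/\ prime p, (p %% 8 = 5)%N, coprime (2 * q) p
                           & (p ^ 2)%:R <= x]) ->
  (#|` fset_set [set I : set OK | idealr_closed (mem I) /\ I (2 * q)%:R]|%fset
    < size ps)%N ->
  (frobenius_count K x [set X]%SET < frobenius_count K x [set Y]%SET)%N.
Proof.
move=> ups psP; rewrite !frobenius_countE.
set BS := [set I : set OK | _]; set FB := fset_set BS => szB.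
have q2 : (2 * q != 0)%N by rewrite muln_eq0 negb_or (bq_q0 S).
have finB : finite_set BS.
  by have [F [r rP]] := finite_residues q2; exact: finite_ideals_over rP.
set FX := fset_set (frob_primes x [set X]%SET).
set FY := fset_set (frob_primes x [set Y]%SET).
have inFX I : (I \in FX) = `[< frob_primes x [set X]%SET I >].
  rewrite in_fset_set; last exact: frob_primes_finite.
  by apply/idP/asboolP; rewrite inE.
have inFY I : (I \in FY) = `[< frob_primes x [set Y]%SET I >].
  rewrite in_fset_set; last exact: frob_primes_finite.
  by apply/idP/asboolP; rewrite inE.
have inFB I : (I \in FB) = `[< BS I >].
  by rewrite in_fset_set //; apply/idP/asboolP; rewrite inE.
pose goodJ I J := [/\ swapped I J, prime_ideal J, unramified E J
              & Frob E J = [set Y]%SET].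
pose phi I := xget I [set J | goodJ I J].
have phiP I : I \in (FX `\` FB)%fset -> goodJ I (phi I).
  rewrite inE inFX inFB => /andP[/asboolP nB /asboolP[prI unI Nx FI]].
  rewrite /phi; case: xgetP => [J _ //|nJ].
  have [J hJ] : exists J, goodJ I J.
    apply: swapped_exists => //; move=> I2q; apply: nB; split=> //.
    by case: prI.
  by case: (nJ J).
have [e eP] : exists e : nat -> set OK, forall p, p \in ps ->
    [/\ prime_ideal (e p), unramified E (e p), ideal_norm (e p) = (p ^ 2)%N,
        Frob E (e p) = [set Y]%SET & e p p%:R].
  have H p : exists I : set OK, p \in ps ->
    [/\ prime_ideal I, unramified E I, ideal_norm I = (p ^ 2)%N,
        Frob E I = [set Y]%SET & I p%:R].
    case: (boolP (p \in ps)) => [/psP[pp p5 p2q _]|_]; last by exists set0.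
    by have [I hI] := inert_prime_exists S pp p5 p2q; exists I.
  by have [e eP] := choice H; exists e.
pose F1 := [fset phi I | I in (FX `\` FB)%fset]%fset.
pose F2 := [fset e p | p in ps]%fset.
have c1 : #|` F1|%fset = #|` (FX `\` FB)|%fset.
  apply: card_in_imfset => I J IX JX ephi.
  have [sI prJ _ _] := phiP I IX; have [sJ _ _ _] := phiP J JX.
  rewrite -ephi in sJ; move: IX JX.
  rewrite !inE !inFX => /andP[_ /asboolP[prI _ _ _]] /andP[_ /asboolP[prI' _ _ _]].
  exact: swapped_inj prI prI' prJ sI sJ.
have c2 : #|` F2|%fset = size ps.
  rewrite card_in_imfset /=; first by rewrite undup_id.
  move=> p p' pps pps' ee.
  have [[idI _ _] _ _ _ Ip] := eP p pps; have [_ _ _ _ Ip'] := eP p' pps'.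
  have [pp _ _ _] := psP p pps; have [pp' _ _ _] := psP p' pps'.
  rewrite -ee in Ip'; apply/eqP; rewrite -dvdn_prime2 //.
  exact: ideal_prime_dvd idI pp Ip Ip'.
(* Matched primes have prime norm, the additional ones have norm [p ^ 2]. *)
have dis : [disjoint F1 & F2]%fset.
  apply/fdisjointP => J /imfsetP[I IX ->]; apply/negP => /imfsetP[p pps ep].
  have [[p' [u [v [[pp' _ _ _] _ _ _ [_ N']]]]] _ _ _] := phiP I IX.
  have [_ _ N _ _] := eP p pps; move: N'; rewrite ep N => eN.
  have [pp _ _ _] := psP p pps; rewrite -eN in pp'.
  have : (p %| p ^ 2)%N by rewrite dvdn_exp.
  by rewrite dvdn_prime2 // -{1}(expn1 p) eqn_exp2l // prime_gt1.
have sub : (F1 `|` F2 `<=` FY)%fset.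
  rewrite fsubUset; apply/andP; split; apply/fsubsetP => J.
    move=> /imfsetP[I IX ->]; rewrite inFY; apply/asboolP.
    have [[p' [u [v [_ _ _ _ [NI NJ]]]]] prJ unJ FJ] := phiP I IX.
    split=> //; rewrite NJ -NI; move: IX.
    by rewrite inE inFX => /andP[_ /asboolP[]].
  move=> /imfsetP[p pps ->]; rewrite inFY; apply/asboolP.
  have [prI unI NI FI _] := eP p pps; split=> //; rewrite NI.
  by have [] := psP p pps.
have := fsubset_leq_card sub; rewrite cardfsU (disjoint_fsetI0 dis) cardfs0 subn0.
rewrite c1 c2; have := cardfsD FX FB; have := fsubset_leq_card (fsubsetIr FX FB).
by move=> h1 h2; lia.
Qed.

End Counting.

(** * Infinitely many non-isomorphic extensions *)

Section Existence.

Lemma quartic_factor (R : comNzRingType) (x a j : R) : j ^+ 2 = -1 ->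
  (x - a) * ((x - j * a) * ((x + a) * (x + j * a))) = x ^+ 4 - a ^+ 4.
Proof.
move=> j2; transitivity ((x ^+ 2 - a ^+ 2) * (x ^+ 2 - j ^+ 2 * a ^+ 2)).
  by ring.
by rewrite j2; ring.
Qed.

(** Adjoin the three complex numbers; the field is normal because
    [(X ^ 4 - A ^ 4) (X ^ 4 - B ^ 4)] has rational coefficients and splits in it. *)
Lemma biquartic_exists q : q != 0%N -> inhabited (biquartic q).
Proof.
move=> q0; pose iC : algC := 'i.
pose AC : algC := 4.-root (q%:R * (1 + iC)).
pose BC : algC := 4.-root (q%:R * (1 - iC)).
have [Qs [QsC [s1 Ds gens]]] := num_field_exists [:: iC; AC; BC].
case: s1 Ds gens => [|i [|A [|B []]]] //= [ei eA eB] gens.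
have i2 : i ^+ 2 = -1.
  by apply: (fmorph_inj QsC); rewrite rmorphXn ei sqrCi rmorphN rmorph1.
have A4 : A ^+ 4 = q%:R * (1 + i).
  apply: (fmorph_inj QsC); rewrite rmorphXn eA rootCK //.
  by rewrite rmorphM rmorph_nat rmorphD rmorph1 ei.
have B4 : B ^+ 4 = q%:R * (1 - i).
  apply: (fmorph_inj QsC); rewrite rmorphXn eB rootCK //.
  by rewrite rmorphM rmorph_nat rmorphB rmorph1 ei.
have gen : <<<<<<1; i>>; A>>; B>>%VS = fullv :> {vspace Qs}.
  by rewrite -gens !adjoin_cons adjoin_nil agenv_id.
have A0 : A != 0.
  apply/eqP => A0; move: A4; rewrite A0 expr0n /= => /esym /(congr1 QsC).
  rewrite rmorphM rmorph_nat rmorphD rmorph1 ei rmorph0 => /eqP.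
  rewrite mulf_eq0 pnatr_eq0 (negPf q0) /= addrC addr_eq0 => /eqP e.
  have := sqrCi algC; rewrite -/iC e sqrrN expr1n => /eqP.
  by rewrite -addr_eq0 -mulr2n pnatr_eq0.
have spl : SplittingField.axiom Qs.
  exists (('X^4 - (A ^+ 4)%:P) * ('X^4 - (B ^+ 4)%:P)).
    have -> : ('X^4 - (A ^+ 4)%:P) * ('X^4 - (B ^+ 4)%:P) =
        ('X^4 - (q%:R)%:P) ^+ 2 + (q%:R ^+ 2)%:P :> {poly Qs}.
      have j2 : (i%:P : {poly Qs}) ^+ 2 = -1 by rewrite -polyC_exp i2 polyCN polyC1.
      rewrite A4 B4 !(polyC_exp, polyCM, polyCD, polyCB, polyC1) /=.
      set x := 'X^4; set c := q%:R%:P; set j := i%:P in j2 *.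
      transitivity ((x - c) ^+ 2 - c ^+ 2 * j ^+ 2); first by ring.
      by rewrite j2; ring.
    by rewrite rpredD ?rpredX ?rpredB ?polyOverXn ?polyOverC ?rpredX ?rpred_nat.
  pose rs := [:: A; i * A; - A; - (i * A); B; i * B; - B; - (i * B)].
  exists rs.
    have j2 : (i%:P : {poly Qs}) ^+ 2 = -1 by rewrite -polyC_exp i2 polyCN polyC1.
    rewrite !polyC_exp -(quartic_factor 'X A%:P j2) -(quartic_factor 'X B%:P j2).
    rewrite /rs !big_cons big_nil mulr1 !(polyCN, polyCM) !opprK -!mulrA.
    exact: eqpxx.
  apply/eqP; rewrite eqEsubv subvf /= -gen.
  pose E : {subfield Qs} := <<1 & rs>>%AS.
  have inrs x : x \in rs -> x \in E by exact: seqv_sub_adjoin.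
  have AE : A \in E by apply: inrs; rewrite !inE eqxx.
  have BE : B \in E by apply: inrs; rewrite !inE eqxx !orbT.
  have iE : i \in E.
    rewrite -(mulfK A0 i); apply: rpred_div => //; apply: inrs.
    by rewrite !inE eqxx !orbT.
  apply/FadjoinP; split=> //; apply/FadjoinP; split=> //.
  by apply/FadjoinP; split=> //; exact: sub1v.
pose L : splittingFieldType rat :=
  HB.pack Qs (FieldExt_isSplittingField.Build rat Qs spl).
exact: (inhabits (@Biquartic q L QsC i A B q0 i2 A4 B4 gen)).
Qed.

End Existence.

Section Distinct.

Lemma prime_mul_nonsquare p n m : prime p -> ~~ (p %| n)%N -> (p * n)%N <> (m ^ 2)%N.
Proof.
move=> pp pn e; have pm : (p %| m)%N.
  by have := dvdn_mulr n (dvdnn p); rewrite e Euclid_dvdX // andbT.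
case/dvdnP: pm => c em; move: pn; apply/negP/negPn/dvdnP; exists (c ^ 2)%N.
apply/eqP; rewrite -(eqn_pmul2l (prime_gt0 pp)) e em; apply/eqP; lia.
Qed.

Definition bq_ext q (S : biquartic q) : galois_ext :=
  GaloisExt (galois_fullv (bq_base S)).

Variables (q q' : nat) (S : biquartic q) (S' : biquartic q').
Hypotheses (qp : prime q) (qp' : prime q') (qq : q != q') (q3 : odd q).
Notation L := (bq_field S).
Notation L' := (bq_field S').
Notation i := (bq_i S').
Notation t := (bq_B S' ^+ 2).
Let i2 := bq_i2 S'.

(** A Gaussian number [d] with [d ^ 2 = q / q'] or [d ^ 2 = i q / q'] would
    make [q q'] or [2 q q'] a perfect square. *)
Lemma gauss_ratio_nonsquare (d : L') : d \in <<1; i>>%VS ->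
  d ^+ 2 * q'%:R <> q%:R /\ d ^+ 2 * q'%:R <> i * q%:R.
Proof.
move=> /gaussP[//|x [y ->]].
have q'q : ~~ (q %| q')%N by rewrite dvdn_prime2.
have q'2q : ~~ (q %| 2 * q')%N.
  rewrite Euclid_dvdM // negb_or q'q andbT dvdn_prime2 //.
  by apply: contraL q3 => /eqP ->.
have n1 : (q'%:R : rat) != 0 by rewrite pnatr_eq0 -lt0n prime_gt0.
have n2 : (q%:R : rat) != 0 by rewrite pnatr_eq0 -lt0n prime_gt0.
have e (z w : rat) : (x%:A + y%:A * i) ^+ 2 * q'%:R = z%:A + w%:A * i ->
    (x ^+ 2 - y ^+ 2) * q'%:R = z /\ (2 * x * y) * q'%:R = w.
  rewrite gauss_sqr // => h; apply: (gauss_inj i2); rewrite -h.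
  have gen (g : {rmorphism rat -> L'}) (a b : rat) :
      g (a * q'%:R) + g (b * q'%:R) * i = (g a + g b * i) * q'%:R.
    by rewrite !rmorphM rmorph_nat; ring.
  exact: (gen (in_alg L')).
split=> h.
  have [e1 e2] : (x ^+ 2 - y ^+ 2) * q'%:R = q%:R /\ (2 * x * y) * q'%:R = 0.
    by apply: e; rewrite h scale0r mul0r addr0 scaler_nat.
  have /eqP : x * y = 0.
    by apply: (mulfI n1); lra.
  rewrite mulf_eq0 => /orP[]/eqP z0.
    have : 0 < (q%:R : rat) by rewrite ltr0n prime_gt0.
    rewrite -e1 z0; have : 0 < (q'%:R : rat) by rewrite ltr0n prime_gt0.
    have := sqr_ge0 y; nra.
  have [m em] : exists m, (q * q')%N = (m ^ 2)%N.
    apply: (@rat_sqr_nat (x * q'%:R)); rewrite natrM -e1 z0; ring.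
  exact: (prime_mul_nonsquare qp q'q em).
have [e1 e2] : (x ^+ 2 - y ^+ 2) * q'%:R = 0 /\ (2 * x * y) * q'%:R = q%:R.
  by apply: e; rewrite h scale0r add0r mulrC scaler_nat.
have /eqP : x ^+ 2 = y ^+ 2 by apply: (mulfI n1); lra.
rewrite eqf_sqr => /orP[]/eqP xy.
  have [m em] : exists m, (q * (2 * q'))%N = (m ^ 2)%N.
    apply: (@rat_sqr_nat (2 * x * q'%:R)); rewrite !natrM -e2 xy; ring.
  exact: (prime_mul_nonsquare qp q'2q em).
have : 0 < (q%:R : rat) by rewrite ltr0n prime_gt0.
rewrite -e2 xy; have : 0 < (q'%:R : rat) by rewrite ltr0n prime_gt0.
have := sqr_ge0 y; nra.
Qed.

(** With [s = c + d B ^ 2], either [q (1 - i)] or its conjugate is the Gaussian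
    square [c ^ 2], which its norm forbids, or it is [d ^ 2 q' (1 - i)]. *)
Lemma base_sqr_neq (s : L') (e : bool) : s \in bq_base S' ->
  s ^+ 2 <> q%:R * (1 - (-1) ^+ e * i).
Proof.
move=> sK; have tE : t ^+ 2 \in <<1; i>>%AS.
  by rewrite -exprM [X in X \in _]bq_B4 rpredM ?rpred_nat ?rpredB ?mem1v ?memv_adjoin.
have [c [d [cE dE es]]] := Fadjoin_sqr tE sK => h.
have t4 : t ^+ 2 = q'%:R * (1 - i) by rewrite -exprM bq_B4.
have q0 : q != 0%N by rewrite -lt0n prime_gt0.
have hE : q%:R * (1 - (-1) ^+ e * i) \in <<1; i>>%AS.
  rewrite rpredM ?rpred_nat // rpredB ?mem1v // rpredM ?memv_adjoin //.
  by rewrite rpredX // rpredN mem1v.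
have hs : s ^+ 2 = c ^+ 2 + d ^+ 2 * t ^+ 2 + 2 * c * d * t by rewrite es; ring.
have [cd|cd] := eqVneq (2 * c * d) 0.
  move: cd => /eqP; rewrite !mulf_eq0 natr_bq_eq0 /= => /orP[]/eqP z0.
    have [r1 r2] := gauss_ratio_nonsquare dE.
    have e1 : d ^+ 2 * q'%:R * (1 - i) = q%:R * (1 - (-1) ^+ e * i).
      by rewrite -h hs z0 t4; ring.
    have i1 : (1 - i) * (1 + i) = 2.
      transitivity (1 - i ^+ 2); first by ring.
      by rewrite i2; ring.
    have t0 : (2 : L') != 0 by rewrite natr_bq_eq0.
    have e2 : 2 * (d ^+ 2 * q'%:R) = q%:R * ((1 - (-1) ^+ e * i) * (1 + i)).
      transitivity ((1 - i) * (1 + i) * (d ^+ 2 * q'%:R)); first by rewrite i1.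
      transitivity (d ^+ 2 * q'%:R * (1 - i) * (1 + i)); first by ring.
      by rewrite e1 mulrA.
    case: e e2 {h hE e1} => e2; [apply: r2|apply: r1]; apply: (mulfI t0); rewrite e2.
      transitivity (q%:R * (1 + i ^+ 2 + 2 * i)); first by rewrite expr1; ring.
      by rewrite i2; ring.
    by rewrite expr0 mul1r i1 mulrC.
  apply: (gauss_sqr_neq (x := q%:R) (y := - (-1) ^+ e * q%:R) i2 q0 cE).
    by case: (e); ring.
  have -> : c ^+ 2 = s ^+ 2 by rewrite hs z0; ring.
  rewrite h; case: (e); rewrite ?expr1 ?expr0.
    by rewrite opprK mul1r !scaler_nat; ring.
  by rewrite mulN1r scaleNr !scaler_nat; ring.
move/negP: (B2_notin_gauss S'); apply.
have -> : t = (q%:R * (1 - (-1) ^+ e * i) - (c ^+ 2 + d ^+ 2 * t ^+ 2)) / (2 * c * d).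
  by apply: (mulfI cd); rewrite mulrC [RHS]mulrC divfK // -h hs; ring.
change (is_true ((q%:R * (1 - (-1) ^+ e * i) - (c ^+ 2 + d ^+ 2 * t ^+ 2))
  / (2 * c * d) \in (<<1; i>>%AS : {subfield L'}))).
apply: rpred_div; first apply: rpredB => //.
  by apply: rpredD; [exact: rpredX|apply: rpredM => //; exact: rpredX].
by apply: rpredM => //; apply: rpredM => //; exact: rpred_nat.
Qed.

(** An isomorphism would send [B ^ 2] to a square root of [q (1 - i)] or
    [q (1 + i)] in the base field of the other extension. *)
Lemma bq_ext_not_iso : ~ galois_ext_iso (bq_ext S) (bq_ext S').
Proof.
case=> f [_ fbase].
pose u (x : L) : subvs_of (ge_top (bq_ext S)) :=
  Subvs (memvf x : x \in ge_top (bq_ext S)).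
pose F (x : L) : L' := vsval (f (u x)).
have FM x y : F (x * y) = F x * F y.
  rewrite /F; have -> : u (x * y) = u x * u y by exact: val_inj.
  by rewrite rmorphM.
have FB x y : F (x - y) = F x - F y.
  rewrite /F; have -> : u (x - y) = u x - u y by exact: val_inj.
  by rewrite rmorphB.
have F1 : F 1 = 1.
  rewrite /F; have -> : u 1 = 1.
    by rewrite -[LHS]mulr1; apply: val_inj; rewrite /= mul1r.
  by rewrite rmorph1 /= algid1.
have F0 : F 0 = 0 by rewrite -(subrr 1) FB subrr.
have FN x : F (- x) = - F x by rewrite -sub0r FB F0 sub0r.
have FD x y : F (x + y) = F x + F y by rewrite -{1}[y]opprK FB FN opprK.
have Fn n : F n%:R = n%:R by elim: n => [|n IH]; [exact: F0|rewrite !mulrSr FD IH F1].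
have Fi : exists e : bool, F (bq_i S) = (-1) ^+ e * i.
  have : F (bq_i S) ^+ 2 = i ^+ 2 by rewrite i2 expr2 -FM -expr2 bq_i2 FN F1.
  by case/sqr_eq_cases => ->; [exists false; rewrite expr0 mul1r
                              |exists true; rewrite expr1 mulN1r].
have [e ei] := Fi.
have sK : F (bq_B S ^+ 2) \in bq_base S'.
  by have := fbase (u (bq_B S ^+ 2)) => /= <-; exact: B2_inK.
apply: (base_sqr_neq (e := e) sK).
by rewrite expr2 -FM -expr2 -exprM bq_B4 FM Fn FB F1 ei.
Qed.

End Distinct.

(** * The density of the bias *)

Section Bias.
Variables (q : nat) (S : biquartic q) (R : realType).
Notation K := (bq_base S).
Notation X := (bq_X S).
Notation Y := (bq_Y S).

(** Norms are natural numbers; hence the bias set is measurable. *)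
Lemma frob_primes_truncn (x : R) C : 1 <= x ->
  frob_primes (S := S) x C = frob_primes ((Num.truncn x)%:R : R) C.
Proof.
move=> x1; have x0 : 0 <= x by exact: le_trans x1.
have e n : (n%:R <= x) = (n%:R <= (Num.truncn x)%:R :> R).
  by rewrite ler_nat truncn_ge_nat.
by apply/seteqP; split=> I [prI unI NI FI]; split=> //; [rewrite -e|rewrite e].
Qed.

Lemma bias_density_one :
  has_log_density (bias_set K [set Y]%SET [set X]%SET : set R) 1.
Proof.
set n0 := #|` fset_set [set I : set (integers K) |
  idealr_closed (mem I) /\ I (2 * q)%:R]|%fset.
have [ps [ups sps psP]] := primes_5mod8 (2 * q) n0.+1.
pose x0 : R := (1 + \sum_(p <- ps) p ^ 2)%:R.
have biasE x : bias_set K [set Y]%SET [set X]%SET x <-> 1 <= x /\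
    (frobenius_count K x [set X]%SET < frobenius_count K x [set Y]%SET)%N.
  by rewrite /bias_set /= !cards1 !mul1n.
apply: (@log_density_one R _ x0).
- apply: measurable_truncn => [x /biasE[]//|x x1].
  split=> /biasE[_ h]; apply/biasE; split=> //.
  + by rewrite ler1n truncn_gt0.
  + move: h; rewrite !frobenius_countE (frob_primes_truncn [set X]%SET x1).
    by rewrite (frob_primes_truncn [set Y]%SET x1).
  + move: h; rewrite !frobenius_countE -(frob_primes_truncn [set X]%SET x1).
    by rewrite -(frob_primes_truncn [set Y]%SET x1).
- by rewrite /x0 ler1n.
move=> x x0x; apply/biasE; split.
  by apply: le_trans x0x; rewrite ler1n.
apply: (frobenius_count_lt (ps := ps)) => //; last by rewrite sps.
move=> p pps; have [p2 pp p5] := psP p pps; split=> //.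
  rewrite coprime_sym prime_coprime //; apply/negP => /dvdn_leq.
  by rewrite muln_gt0 /= lt0n (bq_q0 S) => /(_ isT); rewrite leqNgt p2.
apply: le_trans x0x; rewrite ler_nat (big_rem p) //=.
by rewrite addnCA leq_addr.
Qed.

End Bias.

Theorem corollary1p3 (R : realType) :
  exists X : nat -> galois_ext,
    (forall m n : nat, m <> n -> ~ galois_ext_iso (X m) (X n)) /\
    (forall n : nat,
       exists C1 C2 : {set gal_of (ge_top (X n))},
         [/\ C1 \in classes 'Gal(ge_top (X n) / ge_base (X n))%g,
             C2 \in classes 'Gal(ge_top (X n) / ge_base (X n))%g &
             has_log_density
               (bias_set (ge_base (X n)) C1 C2 : set R) 1%R]).
Proof.
have [g gP] := choice prime_5mod8_above.
pose s n := iter n.+1 g 2%N.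
have sS n : (s n < s n.+1)%N by have [] := gP (s n).
have s_mono : {homo s : m n / (m < n)%N}.
  move=> m n; elim: n => // n IH; rewrite ltnS leq_eqVlt => /orP[/eqP->|/IH] //.
  by move=> h; exact: ltn_trans h (sS n).
have sp n : prime (s n) by have [] := gP (iter n g 2%N).
have so n : odd (s n).
  case: (even_prime (sp n)) => // s2.
  have [_ _] := gP (iter n g 2%N); rewrite -[g _]/(s n) s2.
  by [].
have s0 n : s n != 0%N by rewrite -lt0n prime_gt0.
have exS n : exists S : biquartic (s n), True.
  by have [S] := biquartic_exists (s0 n); exists S.
pose S n := projT1 (cid (exS n)).
exists (fun n => bq_ext (S n)); split.
  move=> m n mn; apply: bq_ext_not_iso => //.
  apply/eqP => e; move/eqP: mn; rewrite neq_ltn => /orP[]/s_mono; rewrite e ltnn //.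
move=> n; exists [set bq_Y (S n)]%SET, [set bq_X (S n)]%SET; split.
- exact/central_class/bq_Y_inG.
- exact/central_class/bq_X_inG.
- exact: bias_density_one.
Qed.
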